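(* Let $f^*\colon\mathcal{C}\to\mathcal{D}$ be a proxy-small geometric functor between rigidly-compactly generated tt-categories and let $M\in\mathcal{C}$. If $f^*M$ is rigid in $\mathcal{D}$, then there is a natural isomorphism $$f^{!}X\otimes f^*M\simeq f^{!}(X\otimes M)$$ for all $X\in\mathcal{C}$. In particular, if $f^*M$ is rigid there is an isomorphism $$\omega_f\otimes f^*M\simeq f^{!}M,$$ where $\omega_f=f^!(\mathbb{1}_{\mathcal{C}})$.
   Context: A tt-category is a triangulated category with a compatible closed symmetric monoidal structure, with tensor $\otimes$, unit $\mathbb{1}_{\mathcal{C}}$, internal hom $\underline{\mathrm{Hom}}$, and $D=\underline{\mathrm{Hom}}(-,\mathbb{1})$. An object $M$ is rigid if the canonical map $DM\otimes N\to\underline{\mathrm{Hom}}(M,N)$ is an isomorphism for all $N$. A tt-category is rigidly-compactly generated if it is compactly generated and its rigid objects coincide with its compact objects. A geometric functor $f^*\colon\mathcal{C}\to\mathcal{D}$ between rigidly-compactly generated tt-categories is a strong symmetric monoidal, triangulated, coproduct-preserving functor; it has a right adjoint $f_*$, which has a right adjoint $f^!$. $\mathrm{thick}_\otimes(\mathcal{X})$ is the smallest thick subcategory containing $\mathcal{X}$ and closed under tensoring with rigid objects; $\mathrm{Loc}_\otimes(\mathcal{X})$ is the smallest localising subcategory containing $\mathcal{X}$ and closed under tensoring with arbitrary objects. The geometric functor $f^*$ is proxy-small if $f_*\mathbb{1}_{\mathcal{D}}$ is proxy-small, i.e. there is a set $\mathcal{W}$ of compact objects of $\mathcal{C}$ with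 $\mathcal{W}\subseteq\mathrm{thick}_\otimes(f_*\mathbb{1}_{\mathcal{D}})$ and $f_*\mathbb{1}_{\mathcal{D}}\in\mathrm{Loc}_\otimes(\mathcal{W})$. *)

(* Defs.v *)
From mathcomp Require Import all_boot ssralg.

Set Implicit Arguments.
Unset Strict Implicit.
Unset Printing Implicit Defensive.

Import GRing.Theory.
Local Open Scope ring_scope.

Declare Scope cat_scope.
Delimit Scope cat_scope with cat.
Local Open Scope cat_scope.

(** * Preadditive categories, functors, adjunctions *)

(* Composition is written in the usual (right-to-left) order. *)
Record preadditive := Preadditive {
  ob :> Type;
  mor : ob -> ob -> zmodType;
  idm : forall A, mor A A;
  compose : forall A B C, mor B C -> mor A B -> mor A C;
  composeA : forall A B C E (h : mor C E) (g : mor B C) (f : mor A B),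
    compose h (compose g f) = compose (compose h g) f;
  compose1m : forall A B (f : mor A B), compose (idm B) f = f;
  composem1 : forall A B (f : mor A B), compose f (idm A) = f;
  composeDl : forall A B C (g g' : mor B C) (f : mor A B),
    compose (g + g') f = compose g f + compose g' f;
  composeDr : forall A B C (g : mor B C) (f f' : mor A B),
    compose g (f + f') = compose g f + compose g f'
}.

Arguments idm {C} A : rename.
Arguments mor {C} A B : rename.
Arguments compose {C A B E} g f : rename.
Notation "g ∘ f" := (compose g f) (at level 40, left associativity) : cat_scope.

Record iso (C : preadditive) (A B : C) := Iso {
  ifwd :> mor A B;
  iinv : mor B A;
  iinvK : iinv ∘ ifwd = idm A;
  ifwdK : ifwd ∘ iinv = idm B
}.

Definition is_iso (C : preadditive) (A B : C) (f : mor A B) : Prop :=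
  exists g : mor B A, g ∘ f = idm A /\ f ∘ g = idm B.

Definition isomorphic (C : preadditive) (A B : C) : Prop := inhabited (iso A B).

Definition is_zero (C : preadditive) (Z : C) : Prop := idm Z = 0.

Definition has_biproducts (C : preadditive) : Prop :=
  forall A B : C, exists (S : C) (i : mor A S) (j : mor B S)
                         (p : mor S A) (q : mor S B),
    [/\ p ∘ i = idm A, q ∘ j = idm B, p ∘ j = 0, q ∘ i = 0
      & i ∘ p + j ∘ q = idm S].

Definition is_additive (C : preadditive) : Prop :=
  (exists Z : C, is_zero Z) /\ has_biproducts C.

Record functor (C D : preadditive) := Functor {
  fobj :> C -> D;
  fmap : forall A B : C, mor A B -> mor (fobj A) (fobj B);
  fmap1 : forall A : C, fmap (idm A) = idm (fobj A);
  fmapM : forall (A B E : C) (g : mor B E) (f : mor A B),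
    fmap (g ∘ f) = fmap g ∘ fmap f
}.

Arguments fmap {C D} F {A B} _ : rename.

Definition additive_functor (C D : preadditive) (F : functor C D) : Prop :=
  forall (A B : C) (f g : mor A B), fmap F (f + g) = fmap F f + fmap F g.

Definition is_equivalence (C D : preadditive) (F : functor C D) : Prop :=
  exists (G : functor D C)
         (u : forall A : C, iso A (G (F A))) (v : forall B : D, iso (F (G B)) B),
    (forall (A A' : C) (f : mor A A'), fmap G (fmap F f) ∘ u A = u A' ∘ f) /\
    (forall (B B' : D) (f : mor B B'), f ∘ v B = v B' ∘ fmap F (fmap G f)).

(* [adjunction F G]: F is left adjoint to G. *)
Record adjunction (C D : preadditive) (F : functor C D) (G : functor D C) :=
  Adjunction {
  unit_adj : forall A : C, mor A (G (F A));
  counit_adj : forall B : D, mor (F (G B)) B;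
  unit_adj_nat : forall (A A' : C) (f : mor A A'),
    fmap G (fmap F f) ∘ unit_adj A = unit_adj A' ∘ f;
  counit_adj_nat : forall (B B' : D) (f : mor B B'),
    f ∘ counit_adj B = counit_adj B' ∘ fmap F (fmap G f);
  triangle_l : forall A : C,
    counit_adj (F A) ∘ fmap F (unit_adj A) = idm (F A);
  triangle_r : forall B : D,
    fmap G (counit_adj B) ∘ unit_adj (G B) = idm (G B)
}.

(** * Coproducts and compact objects *)

(* Small index sets are choiceTypes; as every zmodType is a choiceType, the
   hom groups themselves are small. *)
Definition is_coproduct (C : preadditive) (I : choiceType) (F : I -> C) (S : C)
    (inj : forall k, mor (F k) S) : Prop :=
  forall (T : C) (g : forall k, mor (F k) T),
    exists! u : mor S T, forall k, u ∘ inj k = g k.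

Definition has_coproducts (C : preadditive) : Prop :=
  forall (I : choiceType) (F : I -> C),
    exists (S : C) (inj : forall k, mor (F k) S), is_coproduct inj.

Definition preserves_coproducts (C D : preadditive) (F : functor C D) : Prop :=
  forall (I : choiceType) (X : I -> C) (S : C) (inj : forall k, mor (X k) S),
    is_coproduct inj -> is_coproduct (fun k => fmap F (inj k)).

(* The canonical map from the direct sum of the groups Hom(K, F k) to
   Hom(K, coprod F) is bijective; an element of the direct sum is a family g
   vanishing outside some finite set s of indices. *)
Definition compact (C : preadditive) (K : C) : Prop :=
  forall (I : choiceType) (F : I -> C) (S : C) (inj : forall k, mor (F k) S),
    is_coproduct inj ->
    forall f : mor K S, exists! g : (forall k, mor K (F k)),
      exists s : seq I,
        [/\ uniq s, forall k, k \notin s -> g k = 0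
          & f = \sum_(k <- s) inj k ∘ g k].

(** * Triangulated categories *)

Record triangulated := Triangulated {
  tri_cat :> preadditive;
  tri_additive : is_additive tri_cat;
  susp : functor tri_cat tri_cat;
  susp_additive : additive_functor susp;
  susp_equiv : is_equivalence susp;
  dist : forall X Y Z : tri_cat,
    mor X Y -> mor Y Z -> mor Z (susp X) -> Prop;
  dist_id : forall X Z : tri_cat, is_zero Z ->
    dist (idm X) (0 : mor X Z) (0 : mor Z (susp X));
  dist_iso : forall (X Y Z X' Y' Z' : tri_cat)
      (f : mor X Y) (g : mor Y Z) (h : mor Z (susp X))
      (f' : mor X' Y') (g' : mor Y' Z') (h' : mor Z' (susp X'))
      (a : iso X X') (b : iso Y Y') (c : iso Z Z'),
    b ∘ f = f' ∘ a -> c ∘ g = g' ∘ b -> fmap susp a ∘ h = h' ∘ c ->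
    dist f g h -> dist f' g' h';
  dist_complete : forall (X Y : tri_cat) (f : mor X Y),
    exists (Z : tri_cat) (g : mor Y Z) (h : mor Z (susp X)), dist f g h;
  dist_rotate : forall (X Y Z : tri_cat)
      (f : mor X Y) (g : mor Y Z) (h : mor Z (susp X)),
    dist f g h <-> dist g h (- fmap susp f);
  dist_fill : forall (X Y Z X' Y' Z' : tri_cat)
      (f : mor X Y) (g : mor Y Z) (h : mor Z (susp X))
      (f' : mor X' Y') (g' : mor Y' Z') (h' : mor Z' (susp X'))
      (a : mor X X') (b : mor Y Y'),
    dist f g h -> dist f' g' h' -> b ∘ f = f' ∘ a ->
    exists c : mor Z Z', c ∘ g = g' ∘ b /\ fmap susp a ∘ h = h' ∘ c;
  dist_octahedral : forall (X Y Z A B E : tri_cat)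
      (f : mor X Y) (g : mor Y Z)
      (u : mor Y A) (u' : mor A (susp X))
      (v : mor Z B) (v' : mor B (susp Y))
      (w : mor Z E) (w' : mor E (susp X)),
    dist f u u' -> dist g v v' -> dist (g ∘ f) w w' ->
    exists (a : mor A E) (b : mor E B),
      [/\ dist a b (fmap susp u ∘ v'),
          a ∘ u = w ∘ g, w' ∘ a = u',
          b ∘ w = v & v' ∘ b = fmap susp f ∘ w']
}.

Arguments susp {t}.
Arguments dist {t X Y Z} f g h.

Definition is_triangulated_sub (C : triangulated) (P : C -> Prop) : Prop :=
  [/\ forall Z : C, is_zero Z -> P Z,
      forall X Y : C, iso X Y -> P X -> P Y,
      forall X : C, P X <-> P (susp X)
    & forall (X Y Z : C) (f : mor X Y) (g : mor Y Z) (h : mor Z (susp X)),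
        dist f g h -> P X -> P Y -> P Z].

Definition is_thick (C : triangulated) (P : C -> Prop) : Prop :=
  is_triangulated_sub P /\
  forall (X Y : C) (s : mor X Y) (r : mor Y X), r ∘ s = idm X -> P Y -> P X.

Definition is_localising (C : triangulated) (P : C -> Prop) : Prop :=
  is_triangulated_sub P /\
  forall (I : choiceType) (F : I -> C) (S : C) (inj : forall k, mor (F k) S),
    is_coproduct inj -> (forall k, P (F k)) -> P S.

(* Some small family of compact objects is contained in no proper localising
   subcategory. *)
Definition compactly_generated (C : triangulated) : Prop :=
  has_coproducts C /\
  exists (I : choiceType) (G : I -> C),
    (forall k, compact (G k)) /\
    forall P : C -> Prop, is_localising P -> (forall k, P (G k)) ->
      forall X : C, P X.

Record exact_structure (C D : triangulated) (F : functor C D) :=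
  ExactStructure {
  exact_additive : additive_functor F;
  exact_susp : forall X : C, iso (F (susp X)) (susp (F X));
  exact_susp_nat : forall (X Y : C) (f : mor X Y),
    fmap susp (fmap F f) ∘ exact_susp X = exact_susp Y ∘ fmap F (fmap susp f);
  exact_dist : forall (X Y Z : C)
      (f : mor X Y) (g : mor Y Z) (h : mor Z (susp X)),
    dist f g h -> dist (fmap F f) (fmap F g) (exact_susp X ∘ fmap F h)
}.

(** * Closed symmetric monoidal structures and tt-categories *)

Reserved Notation "A ⊗ B" (at level 40, left associativity).
Reserved Notation "f ⊠ g" (at level 40, left associativity).

(* No compatibility with the triangulation is imposed at this stage. *)
Record csm_triangulated := CsmTriangulated {
  csm_tri :> triangulated;
  tens : csm_tri -> csm_tri -> csm_tri
    where "A ⊗ B" := (tens A B);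
  tensm : forall A A' B B' : csm_tri,
    mor A A' -> mor B B' -> mor (A ⊗ B) (A' ⊗ B')
    where "f ⊠ g" := (tensm f g);
  tensm1 : forall A B : csm_tri, idm A ⊠ idm B = idm (A ⊗ B);
  tensmM : forall (A A' A'' B B' B'' : csm_tri)
      (f' : mor A' A'') (f : mor A A') (g' : mor B' B'') (g : mor B B'),
    (f' ∘ f) ⊠ (g' ∘ g) = (f' ⊠ g') ∘ (f ⊠ g);
  tensmDl : forall (A A' B B' : csm_tri) (f f' : mor A A') (g : mor B B'),
    (f + f') ⊠ g = f ⊠ g + f' ⊠ g;
  tensmDr : forall (A A' B B' : csm_tri) (f : mor A A') (g g' : mor B B'),
    f ⊠ (g + g') = f ⊠ g + f ⊠ g';
  tunit : csm_tri;
  assoc : forall A B C : csm_tri, iso ((A ⊗ B) ⊗ C) (A ⊗ (B ⊗ C));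
  lunit : forall A : csm_tri, iso (tunit ⊗ A) A;
  runit : forall A : csm_tri, iso (A ⊗ tunit) A;
  braid : forall A B : csm_tri, iso (A ⊗ B) (B ⊗ A);
  assoc_nat : forall (A A' B B' C C' : csm_tri)
      (f : mor A A') (g : mor B B') (h : mor C C'),
    (f ⊠ (g ⊠ h)) ∘ assoc A B C = assoc A' B' C' ∘ ((f ⊠ g) ⊠ h);
  lunit_nat : forall (A A' : csm_tri) (f : mor A A'),
    f ∘ lunit A = lunit A' ∘ (idm tunit ⊠ f);
  runit_nat : forall (A A' : csm_tri) (f : mor A A'),
    f ∘ runit A = runit A' ∘ (f ⊠ idm tunit);
  braid_nat : forall (A A' B B' : csm_tri) (f : mor A A') (g : mor B B'),
    (g ⊠ f) ∘ braid A B = braid A' B' ∘ (f ⊠ g);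
  pentagon : forall A B C E : csm_tri,
    assoc A B (C ⊗ E) ∘ assoc (A ⊗ B) C E
    = (idm A ⊠ assoc B C E) ∘ assoc A (B ⊗ C) E ∘ (assoc A B C ⊠ idm E);
  unit_triangle : forall A B : csm_tri,
    (idm A ⊠ lunit B) ∘ assoc A tunit B = runit A ⊠ idm B;
  hexagon : forall A B C : csm_tri,
    assoc B C A ∘ braid A (B ⊗ C) ∘ assoc A B C
    = (idm B ⊠ braid A C) ∘ assoc B A C ∘ (braid A B ⊠ idm C);
  braidK : forall A B : csm_tri, braid B A ∘ braid A B = idm (A ⊗ B);
  ihom : csm_tri -> csm_tri -> csm_tri;
  eval : forall A B : csm_tri, mor (ihom A B ⊗ A) B;
  curry : forall T A B : csm_tri, mor (T ⊗ A) B -> mor T (ihom A B);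
  eval_curry : forall (T A B : csm_tri) (g : mor (T ⊗ A) B),
    eval A B ∘ (curry g ⊠ idm A) = g;
  curry_eval : forall (T A B : csm_tri) (k : mor T (ihom A B)),
    curry (eval A B ∘ (k ⊠ idm A)) = k
}.

Arguments tens {c} A B.
Arguments tensm {c A A' B B'} f g.
Arguments tunit {c}.
Arguments assoc {c} A B C.
Arguments lunit {c} A.
Arguments runit {c} A.
Arguments braid {c} A B.
Arguments ihom {c} A B.
Arguments eval {c} A B.
Arguments curry {c T A B} _.

Notation "A ⊗ B" := (tens A B) : cat_scope.
Notation "f ⊠ g" := (tensm f g) : cat_scope.

(* Contravariant in the first variable, covariant in the second. *)
Definition ihomm (C : csm_triangulated) (A A' B B' : C)
    (f : mor A' A) (g : mor B B') : mor (ihom A B) (ihom A' B') :=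
  curry (g ∘ eval A B ∘ (idm (ihom A B) ⊠ f)).

Definition tt_dual (C : csm_triangulated) (M : C) : C := ihom M tunit.

(* The adjoint of
   (DM ⊗ N) ⊗ M ≅ N ⊗ (DM ⊗ M) --N ⊗ eval--> N ⊗ 1 ≅ N. *)
Definition dual_tens_to_ihom (C : csm_triangulated) (M N : C) :
    mor (tt_dual M ⊗ N) (ihom M N) :=
  curry (runit N ∘ (idm N ⊠ eval M tunit) ∘ assoc N (tt_dual M) M
         ∘ (braid (tt_dual M) N ⊠ idm M)).

Definition rigid (C : csm_triangulated) (M : C) : Prop :=
  forall N : C, is_iso (dual_tens_to_ihom M N).

Section SuspensionComparison.

Variables (C : csm_triangulated).
Variable e : forall X Y : C, iso (susp X ⊗ Y) (susp (X ⊗ Y)).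

(* The inverse of the analogue X ⊗ ΣY ≅ Σ(X ⊗ Y) of e in the second variable,
   obtained from e by means of the symmetry. *)
Definition susp_to_tens_r (X Y : C) : mor (susp (X ⊗ Y)) (X ⊗ susp Y) :=
  braid (susp Y) X ∘ iinv (e Y X) ∘ fmap susp (braid X Y).

(* ΣHom(W,X) -> Hom(W,ΣX), adjoint of
   ΣHom(W,X) ⊗ W ≅ Σ(Hom(W,X) ⊗ W) --Σeval--> ΣX. *)
Definition ihom_susp_r (W X : C) : mor (susp (ihom W X)) (ihom W (susp X)) :=
  curry (fmap susp (eval W X) ∘ e (ihom W X) W).

(* ΣHom(ΣX,W) -> Hom(X,W), adjoint of
   ΣHom(ΣX,W) ⊗ X ≅ Σ(Hom(ΣX,W) ⊗ X) ≅ Hom(ΣX,W) ⊗ ΣX --eval--> W. *)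
Definition ihom_susp_l (X W : C) : mor (susp (ihom (susp X) W)) (ihom X W) :=
  curry (eval (susp X) W ∘ susp_to_tens_r (ihom (susp X) W) X
         ∘ e (ihom (susp X) W) X).

End SuspensionComparison.

(* Compatibility of the closed symmetric monoidal structure with the
   triangulation in the sense of Hovey, Palmieri and Strickland (Axiomatic
   stable homotopy theory, Definition A.2.1).  The maps ihom_susp_r and
   ihom_susp_l are invertible, so the connecting map d is determined by its
   equation in each of tt_ihom_dist_r and tt_ihom_dist_l.  With the
   identification ihom_susp_l no sign appears in tt_ihom_dist_l; a sign arises
   on rotating that triangle to start at the desuspension of ihom X W.  The
   symmetry of Σ1 ⊗ Σ1 determines that of all Σ^r 1 ⊗ Σ^s 1. *)
Record ttCategory := TTCategory {
  tt_csm :> csm_triangulated;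
  tens_susp : forall X Y : tt_csm, iso (susp X ⊗ Y) (susp (X ⊗ Y));
  tens_susp_nat : forall (X X' Y Y' : tt_csm) (f : mor X X') (g : mor Y Y'),
    fmap susp (f ⊠ g) ∘ tens_susp X Y = tens_susp X' Y' ∘ (fmap susp f ⊠ g);
  tens_susp_unit : forall X : tt_csm,
    fmap susp (runit X) ∘ tens_susp X tunit = runit (susp X);
  tens_susp_assoc : forall X Y Z : tt_csm,
    fmap susp (assoc X Y Z) ∘ tens_susp (X ⊗ Y) Z ∘ (tens_susp X Y ⊠ idm Z)
    = tens_susp X (Y ⊗ Z) ∘ assoc (susp X) Y Z;
  tt_tens_dist : forall (X Y Z W : tt_csm)
      (f : mor X Y) (g : mor Y Z) (h : mor Z (susp X)),
    dist f g h ->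
    dist (f ⊠ idm W) (g ⊠ idm W) (tens_susp X W ∘ (h ⊠ idm W));
  tt_ihom_dist_r : forall (X Y Z W : tt_csm)
      (f : mor X Y) (g : mor Y Z) (h : mor Z (susp X)),
    dist f g h ->
    exists d : mor (ihom W Z) (susp (ihom W X)),
      ihom_susp_r tens_susp W X ∘ d = ihomm (idm W) h /\
      dist (ihomm (idm W) f) (ihomm (idm W) g) d;
  tt_ihom_dist_l : forall (X Y Z W : tt_csm)
      (f : mor X Y) (g : mor Y Z) (h : mor Z (susp X)),
    dist f g h ->
    exists d : mor (ihom X W) (susp (ihom Z W)),
      d ∘ ihom_susp_l tens_susp X W = fmap susp (ihomm h (idm W)) /\
      dist (ihomm g (idm W)) (ihomm f (idm W)) d;
  tt_braid_susp :
    ifwd (braid (susp tunit) (susp tunit))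
    = - idm (susp (tunit : tt_csm) ⊗ susp (tunit : tt_csm))
}.

Definition rigidly_compactly_generated (C : ttCategory) : Prop :=
  compactly_generated C /\ forall X : C, rigid X <-> compact X.

Definition thick_tens (C : ttCategory) (X : C -> Prop) (A : C) : Prop :=
  forall P : C -> Prop,
    is_thick P ->
    (forall R B : C, rigid R -> P B -> P (R ⊗ B)) ->
    (forall B : C, X B -> P B) ->
    P A.

Definition loc_tens (C : ttCategory) (X : C -> Prop) (A : C) : Prop :=
  forall P : C -> Prop,
    is_localising P ->
    (forall T B : C, P B -> P (T ⊗ B)) ->
    (forall B : C, X B -> P B) ->
    P A.

Definition proxy_small_object (C : ttCategory) (A : C) : Prop :=
  exists (I : choiceType) (W : I -> C),
    [/\ forall k, compact (W k),
        forall k, thick_tens (fun B => B = A) (W k)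
      & loc_tens (fun B => exists k, B = W k) A].

(** * Geometric functors *)

Record strong_monoidal (C D : csm_triangulated) (F : functor C D) :=
  StrongMonoidal {
  sm_tens : forall A B : C, iso (F A ⊗ F B) (F (A ⊗ B));
  sm_unit : iso tunit (F tunit);
  sm_nat : forall (A A' B B' : C) (f : mor A A') (g : mor B B'),
    fmap F (f ⊠ g) ∘ sm_tens A B = sm_tens A' B' ∘ (fmap F f ⊠ fmap F g);
  sm_assoc : forall A B E : C,
    fmap F (assoc A B E) ∘ sm_tens (A ⊗ B) E ∘ (sm_tens A B ⊠ idm (F E))
    = sm_tens A (B ⊗ E) ∘ (idm (F A) ⊠ sm_tens B E)
      ∘ assoc (F A) (F B) (F E);
  sm_lunit : forall A : C,
    fmap F (lunit A) ∘ sm_tens tunit A ∘ (sm_unit ⊠ idm (F A)) = lunit (F A);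
  sm_runit : forall A : C,
    fmap F (runit A) ∘ sm_tens A tunit ∘ (idm (F A) ⊠ sm_unit) = runit (F A);
  sm_braid : forall A B : C,
    fmap F (braid A B) ∘ sm_tens A B = sm_tens B A ∘ braid (F A) (F B)
}.

Record geometric_functor (C D : ttCategory) := GeometricFunctor {
  geo_functor :> functor C D;
  geo_monoidal : strong_monoidal geo_functor;
  geo_exact : exact_structure geo_functor;
  geo_coproducts : preserves_coproducts geo_functor
}.

(* A geometric functor, given with a right adjoint fs (pushforward), is
   proxy-small; fs is unique up to isomorphism. *)
Definition proxy_small (C D : ttCategory) (f : geometric_functor C D)
    (fs : functor D C) (adj : adjunction f fs) : Prop :=
  proxy_small_object (fs tunit).

(* Main.v *)
From Pilot Require Import Defs.
From mathcomp Require Import all_boot ssralg.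
From Stdlib Require Import IndefiniteDescription FunctionalExtensionality.
Import Pilot.Defs.

(** Write [f_push] and [f_shriek] for the successive right adjoints of a
    geometric functor [f]. For any [M] there is a natural comparison map from
    [f M ⊗ f_shriek X] to [f_shriek (M ⊗ X)], and the claim is that it is
    invertible when [f M] is rigid and [f] is proxy-small; the symmetry puts it
    into the form stated.

    Formal part. Let [C] act on itself by [N ⊗ X] and on [D] by [f N ⊗ Y]. Then
    [f] is a strong module functor, so [f_push] is a lax one
    ([right_adjoint_lax]); any lax module functor is strong on rigid objects
    ([lax_rigid_iso]). As rigid objects generate [C], [f_push] is strong on all
    objects ([projection_formula]), so its right adjoint [f_shriek] is lax, with
    structure map the comparison map above, invertible for [M] rigid.

    Reduction to the rigid case. Let [A = f_push 1] and let [W] be one of the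
    compact objects that witness proxy-smallness. Maps from [M] to [A ⊗ S] are
    maps from [f M] to [f S], and [f M] is compact, so every map from [M] to
    [A ⊗ S] with [S] a coproduct is finitely supported. The objects that can
    replace [A] here form a thick tensor ideal ([relatively_compact_thick]),
    which therefore contains [W] and the dual of [W]; by duality [W ⊗ M] is
    compact, hence rigid ([relatively_compact_rigid]). The comparison maps for
    [W] and for [W ⊗ M] are then invertible, and coherence shows that the one
    for [M] becomes invertible after tensoring with [f W] ([lax_isor]).

    Conclusion. Let [Z] be the cone of the comparison map for [M]. The [T] with
    [f T ⊗ Z = 0] form a localising tensor ideal containing every [W], hence
    also [A]. By the projection formula [A ⊗ f_push (Z ⊗ Y) = 0], and
    [f_push (Z ⊗ Y)] is a retract of it, so vanishes for all [Y]; this forces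
    [Z = 0] ([push_tens_zero]). *)

Set Implicit Arguments.
Unset Strict Implicit.
Unset Printing Implicit Defensive.

Import GRing.Theory.
Local Open Scope ring_scope.
Local Open Scope cat_scope.

(** * Preadditive categories *)

Section Preadditive.
Variable C : preadditive.
Implicit Types A B E T X Y Z : C.

Lemma comp_under A B E T (g : mor B E) (f : mor A B) (r : mor A E)
    (h : mor E T) : g ∘ f = r -> h ∘ g ∘ f = h ∘ r.
Proof. by move=> <-; rewrite composeA. Qed.

Lemma comp0m A B E (f : mor A B) : (0 : mor B E) ∘ f = 0.
Proof. by apply: (addrI (0 ∘ f)); rewrite -composeDl !addr0. Qed.

Lemma compm0 A B E (g : mor B E) : g ∘ (0 : mor A B) = 0.
Proof. by apply: (addrI (g ∘ 0)); rewrite -composeDr !addr0. Qed.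

Lemma compNm A B E (g : mor B E) (f : mor A B) : (- g) ∘ f = - (g ∘ f).
Proof. by apply: (addrI (g ∘ f)); rewrite -composeDl !subrr comp0m. Qed.

Lemma compmN A B E (g : mor B E) (f : mor A B) : g ∘ (- f) = - (g ∘ f).
Proof. by apply: (addrI (g ∘ f)); rewrite -composeDr !subrr compm0. Qed.

Lemma compmB A B E (g : mor B E) (f f' : mor A B) :
  g ∘ (f - f') = g ∘ f - g ∘ f'.
Proof. by rewrite composeDr compmN. Qed.

Lemma compm_sum A B E (g : mor B E) (I : Type) (s : seq I) (F : I -> mor A B) :
  g ∘ (\sum_(i <- s) F i) = \sum_(i <- s) g ∘ F i.
Proof.
elim: s => [|i s IHs]; first by rewrite !big_nil compm0.
by rewrite !big_cons composeDr IHs.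
Qed.

Lemma comp_summ A B E (I : Type) (s : seq I) (F : I -> mor B E) (f : mor A B) :
  (\sum_(i <- s) F i) ∘ f = \sum_(i <- s) F i ∘ f.
Proof.
elim: s => [|i s IHs]; first by rewrite !big_nil comp0m.
by rewrite !big_cons composeDl IHs.
Qed.

Definition id_iso A : iso A A :=
  Iso (composem1 (idm A)) (composem1 (idm A)).

Definition iso_sym A B (e : iso A B) : iso B A := Iso (ifwdK e) (iinvK e).

Lemma iso_trans_subproof A B E (d : iso A B) (e : iso B E) :
  (iinv d ∘ iinv e) ∘ (e ∘ d) = idm A /\ (e ∘ d) ∘ (iinv d ∘ iinv e) = idm E.
Proof.
rewrite !composeA (comp_under _ (iinvK e)) (comp_under _ (ifwdK d)).
by rewrite !composem1 iinvK ifwdK.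
Qed.

Definition iso_trans A B E (d : iso A B) (e : iso B E) : iso A E :=
  Iso (proj1 (iso_trans_subproof d e)) (proj2 (iso_trans_subproof d e)).

Lemma iso_epi A B (e : iso A B) E (g g' : mor B E) : g ∘ e = g' ∘ e -> g = g'.
Proof.
move=> H; rewrite -[g]composem1 -[g']composem1 -(ifwdK e) !composeA.
by rewrite H.
Qed.

Lemma iso_mono A B (e : iso A B) E (g g' : mor E A) : e ∘ g = e ∘ g' -> g = g'.
Proof.
move=> H; rewrite -[g]compose1m -[g']compose1m -(iinvK e) -!composeA.
by rewrite H.
Qed.

Lemma iso_is_iso A B (e : iso A B) : is_iso e.
Proof. by exists (iinv e); rewrite iinvK ifwdK. Qed.

Lemma is_iso_iso A B (f : mor A B) : is_iso f -> exists e : iso A B, f = e.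
Proof. by case=> g [gf fg]; exists (Iso gf fg). Qed.

Definition iso_of A B (f : mor A B) (fI : is_iso f) : iso A B :=
  sval (constructive_indefinite_description _ (is_iso_iso fI)).

Lemma iso_ofE A B (f : mor A B) (fI : is_iso f) : iso_of fI = f :> mor A B.
Proof. by rewrite /iso_of; case: constructive_indefinite_description. Qed.

Lemma iso_ofK A B (f : mor A B) (fI : is_iso f) :
  iinv (iso_of fI) ∘ f = idm A.
Proof. by rewrite -{2}(iso_ofE fI) iinvK. Qed.

Lemma iso_inv_nat A A' B B' (e : iso A B) (e' : iso A' B') (u : mor A A')
    (v : mor B B') : v ∘ e = e' ∘ u -> iinv e' ∘ v = u ∘ iinv e.
Proof.
move=> ve; apply: (iso_epi (e := e)); apply: (iso_mono (e := e')).
rewrite -!composeA ve iinvK composem1 [iinv e' ∘ _]composeA iinvK.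
by rewrite compose1m.
Qed.

Lemma is_iso_comp A B E (g : mor B E) (f : mor A B) :
  is_iso g -> is_iso f -> is_iso (g ∘ f).
Proof.
move=> /is_iso_iso [d ->] /is_iso_iso [e ->].
exact: (iso_is_iso (iso_trans e d)).
Qed.

Lemma is_iso_compl A B E (g : mor B E) (f : mor A B) :
  is_iso g -> is_iso (g ∘ f) -> is_iso f.
Proof.
move=> /is_iso_iso [d ->] gfI.
rewrite -[f]compose1m -(iinvK d) -composeA.
exact: is_iso_comp (iso_is_iso (iso_sym d)) gfI.
Qed.

Lemma is_iso_compr A B E (g : mor B E) (f : mor A B) :
  is_iso f -> is_iso (g ∘ f) -> is_iso g.
Proof.
move=> /is_iso_iso [d ->] gfI.
rewrite -[g]composem1 -(ifwdK d) composeA.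
exact: is_iso_comp gfI (iso_is_iso (iso_sym d)).
Qed.

Lemma mor_to_zero A Z (f : mor A Z) : is_zero Z -> f = 0.
Proof. by move=> Z0; rewrite -[f]compose1m Z0 comp0m. Qed.

Lemma mor_from_zero A Z (f : mor Z A) : is_zero Z -> f = 0.
Proof. by move=> Z0; rewrite -[f]composem1 Z0 compm0. Qed.

Lemma retract_zero X Y (s : mor X Y) (r : mor Y X) :
  r ∘ s = idm X -> is_zero Y -> is_zero X.
Proof. by move=> rs Y0; rewrite /is_zero -rs (mor_to_zero s Y0) compm0. Qed.

Lemma iso_zero X Y : iso X Y -> is_zero X -> is_zero Y.
Proof. by move=> e; apply: (retract_zero (ifwdK e)). Qed.

(** The two rows need not be triangles: all that a chase with generalised
    elements requires is that composites vanish and that the kernels below are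
    weak kernels. *)
Lemma five_lemma (A1 A2 A3 A4 A5 B1 B2 B3 B4 B5 : C)
    (a1 : mor A1 A2) (a2 : mor A2 A3) (a3 : mor A3 A4) (a4 : mor A4 A5)
    (b1 : mor B1 B2) (b2 : mor B2 B3) (b3 : mor B3 B4) (b4 : mor B4 B5)
    (p1 : mor A1 B1) (p2 : mor A2 B2) (p3 : mor A3 B3) (p4 : mor A4 B4)
    (p5 : mor A5 B5) :
  p2 ∘ a1 = b1 ∘ p1 -> p3 ∘ a2 = b2 ∘ p2 -> p4 ∘ a3 = b3 ∘ p3 ->
  p5 ∘ a4 = b4 ∘ p4 ->
  a2 ∘ a1 = 0 -> b4 ∘ b3 = 0 ->
  (forall T (u : mor T A3), a3 ∘ u = 0 -> exists v, u = a2 ∘ v) ->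
  (forall T (u : mor T A4), a4 ∘ u = 0 -> exists v, u = a3 ∘ v) ->
  (forall T (u : mor T B2), b2 ∘ u = 0 -> exists v, u = b1 ∘ v) ->
  (forall T (u : mor T B3), b3 ∘ u = 0 -> exists v, u = b2 ∘ v) ->
  is_iso p1 -> is_iso p2 -> is_iso p4 -> is_iso p5 -> is_iso p3.
Proof.
move=> s1 s2 s3 s4 a21 b43 exA3 exA4 exB2 exB3.
move=> /is_iso_iso [e1 e1E] /is_iso_iso [e2 e2E] /is_iso_iso [e4 e4E].
move=> /is_iso_iso [e5 e5E].
have p3_inj T (u : mor T A3) : p3 ∘ u = 0 -> u = 0.
  move=> p3u.
  have /exA3[v uE] : a3 ∘ u = 0.
    apply: (iso_mono (e := e4)).
    by rewrite -e4E compm0 composeA s3 -composeA p3u compm0.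
  have /exB2[w wE] : b2 ∘ (p2 ∘ v) = 0 by rewrite composeA -s2 -composeA -uE.
  have vE : v = a1 ∘ (iinv e1 ∘ w).
    apply: (iso_mono (e := e2)); rewrite -e2E wE [RHS]composeA s1 -!composeA e1E.
    by rewrite [e1 ∘ _]composeA ifwdK compose1m.
  by rewrite uE vE composeA a21 comp0m.
have [r p3r] : exists r, p3 ∘ r = idm B3.
  have [y yE] : exists y, iinv e4 ∘ b3 = a3 ∘ y.
    apply: exA4; apply: (iso_mono (e := e5)).
    rewrite -e5E compm0 composeA s4 e4E !composeA (comp_under _ (ifwdK e4)).
    by rewrite composem1 b43.
  have b3E : b3 = b3 ∘ (p3 ∘ y).
    by rewrite composeA -s3 -composeA -yE composeA e4E ifwdK compose1m.
  have [z zE] : exists z, idm B3 - p3 ∘ y = b2 ∘ z.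
    by apply: exB3; rewrite compmB -b3E composem1 subrr.
  exists (y + a2 ∘ (iinv e2 ∘ z)).
  rewrite composeDr [X in _ + X]composeA s2 -!composeA e2E.
  by rewrite [e2 ∘ _]composeA ifwdK compose1m -zE addrC subrK.
exists r; split=> //; apply/eqP; rewrite -subr_eq0; apply/eqP; apply: p3_inj.
by rewrite compmB composeA p3r compose1m composem1 subrr.
Qed.

End Preadditive.

(** * Adjunctions *)

Section Adjunction.
Variables (C D : preadditive) (F : functor C D) (G : functor D C).
Variable adj : adjunction F G.

Definition transpose (A : C) (B : D) (v : mor (F A) B) : mor A (G B) :=
  fmap G v ∘ unit_adj adj A.

Lemma transposeK A B (v : mor (F A) B) :
  counit_adj adj B ∘ fmap F (transpose v) = v.
Proof.
by rewrite fmapM composeA -counit_adj_nat -composeA triangle_l composem1.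
Qed.

Lemma transpose_inj A B (u v : mor A (G B)) :
  counit_adj adj B ∘ fmap F u = counit_adj adj B ∘ fmap F v -> u = v.
Proof.
have K (w : mor A (G B)) : w = transpose (counit_adj adj B ∘ fmap F w).
  rewrite /transpose fmapM -composeA unit_adj_nat composeA triangle_r.
  by rewrite compose1m.
by move=> E; rewrite (K u) E -K.
Qed.

Lemma right_adjoint_zero (B : D) : is_zero B -> is_zero (G B).
Proof.
move=> B0; apply: transpose_inj.
by rewrite [LHS]mor_to_zero // [RHS]mor_to_zero.
Qed.

Lemma right_adjoint_additive : additive_functor F -> additive_functor G.
Proof.
move=> addF B B' u v; apply: (transpose_inj).
by rewrite addF composeDr -!counit_adj_nat composeDl.
Qed.

Lemma left_adjoint_coproduct : preserves_coproducts F.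
Proof.
move=> I X S inj injP T g.
have [u [uE uU]] := injP (G T) (fun k => transpose (g k)).
exists (counit_adj adj T ∘ fmap F u); split=> [k|v vE].
  by rewrite -composeA -fmapM uE transposeK.
have vT : v = counit_adj adj T ∘ fmap F (transpose v) by rewrite transposeK.
rewrite vT (uU (transpose v)) // => k; apply: transpose_inj.
by rewrite fmapM composeA !transposeK.
Qed.

End Adjunction.

Lemma additive0 (C D : preadditive) (F : functor C D) : additive_functor F ->
  forall A B : C, fmap F (0 : mor A B) = 0.
Proof.
by move=> addF A B; apply: (addrI (fmap F (0 : mor A B))); rewrite -addF !addr0.
Qed.

Lemma additive_zero (C D : preadditive) (F : functor C D) : additive_functor F ->
  forall Z : C, is_zero Z -> is_zero (F Z).
Proof. by move=> addF Z Z0; rewrite /is_zero -fmap1 Z0 additive0. Qed.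

Definition fmap_iso (C D : preadditive) (F : functor C D) (A B : C)
    (e : iso A B) : iso (F A) (F B).
Proof.
exists (fmap F e) (fmap F (iinv e)); by rewrite -fmapM ?iinvK ?ifwdK fmap1.
Defined.

Lemma fmap_is_iso (C D : preadditive) (F : functor C D) (A B : C)
  (u : mor A B) : is_iso u -> is_iso (fmap F u).
Proof. by case/is_iso_iso=> e ->; apply: (iso_is_iso (fmap_iso F e)). Qed.

(** * Coproducts and finitely supported maps *)

Section Coproducts.
Variables (C : preadditive) (I : choiceType).
Implicit Types (S T K : C) (F : I -> C).

Lemma coproduct_ext F S (inj : forall k, mor (F k) S) T (u v : mor S T) :
  is_coproduct inj -> (forall k, u ∘ inj k = v ∘ inj k) -> u = v.
Proof.
move=> injP uv; have [w [_ wU]] := injP T (fun k => v ∘ inj k).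
by rewrite -(wU u) // -(wU v).
Qed.

Lemma coproduct_iso F F' S S' (inj : forall k, mor (F k) S)
    (inj' : forall k, mor (F' k) S') (p : forall k, mor (F k) (F' k))
    (q : mor S S') :
  is_coproduct inj -> is_coproduct inj' ->
  (forall k, q ∘ inj k = inj' k ∘ p k) -> (forall k, is_iso (p k)) -> is_iso q.
Proof.
move=> injP injP' qE pI; pose e k := iso_of (pI k).
have [r [rE _]] := injP' S (fun k => inj k ∘ iinv (e k)).
have eE k : p k = e k by rewrite iso_ofE.
exists r; split.
  apply: (coproduct_ext injP) => k; rewrite -composeA qE composeA rE.
  by rewrite eE -composeA iinvK compose1m composem1.
apply: (coproduct_ext injP') => k; rewrite -composeA rE composeA qE.
by rewrite eE -composeA ifwdK compose1m composem1.
Qed.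

Lemma coproduct_transport F F' S S' (inj : forall k, mor (F k) S)
    (inj' : forall k, mor (F' k) S') (p : forall k, iso (F k) (F' k))
    (q : iso S S') :
  is_coproduct inj -> (forall k, q ∘ inj k = inj' k ∘ p k) -> is_coproduct inj'.
Proof.
move=> injP qE T g; have [u [uE uU]] := injP T (fun k => g k ∘ p k).
have inj'E k : inj' k = q ∘ inj k ∘ iinv (p k).
  by rewrite qE -composeA ifwdK composem1.
exists (u ∘ iinv q); split=> [k|v vE].
  rewrite inj'E !composeA (comp_under _ (iinvK q)) composem1 uE.
  by rewrite -composeA ifwdK composem1.
rewrite (uU (v ∘ q)); first by rewrite -composeA ifwdK composem1.
by move=> k; rewrite -composeA qE composeA vE.
Qed.

Lemma coproduct_zero F S (inj : forall k, mor (F k) S) :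
  is_coproduct inj -> (forall k, is_zero (F k)) -> is_zero S.
Proof.
move=> injP F0; apply: (coproduct_ext injP) => k.
by rewrite [LHS]mor_from_zero // [RHS]mor_from_zero.
Qed.

(** The projections come from the universal property applied to families of
    identities and zero maps. *)
Lemma coproduct_proj F S (inj : forall k, mor (F k) S) : is_coproduct inj ->
  exists p : forall k, mor S (F k),
    (forall k, p k ∘ inj k = idm (F k)) /\
    (forall j k, j != k -> p j ∘ inj k = 0).
Proof.
move=> injP.
pose d k j : mor (F j) (F k) :=
  match j =P k with
  | ReflectT e => ecast i (mor (F j) (F i)) e (idm (F j))
  | ReflectF _ => 0
  end.
have pP k : exists p : mor S (F k), forall j, p ∘ inj j = d k j.
  by have [p [pE _]] := injP (F k) (d k); exists p.
pose p k := sval (constructive_indefinite_description _ (pP k)).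
have pE k j : p k ∘ inj j = d k j.
  by rewrite /p; case: constructive_indefinite_description.
exists p; split=> [k|j k jk]; rewrite pE /d.
  by case: eqP => // e; rewrite eq_axiomK.
by case: eqP => // e; rewrite e eqxx in jk.
Qed.

(** A list of tagged maps, rather than a family with finite support, makes this
    condition visibly stable under addition, composition and additive
    functors. *)
Definition finitely_supported K F S (inj : forall k, mor (F k) S)
    (u : mor K S) : Prop :=
  exists l : seq {k : I & mor K (F k)},
    u = \sum_(x <- l) inj (tag x) ∘ tagged x.

Lemma finitely_supported_inj K F S (inj : forall k, mor (F k) S) k
    (g : mor K (F k)) : finitely_supported inj (inj k ∘ g).
Proof. by exists [:: Tagged (fun k => mor K (F k)) g]; rewrite big_seq1. Qed.

Lemma finitely_supportedD K F S (inj : forall k, mor (F k) S) (u v : mor K S) :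
  finitely_supported inj u -> finitely_supported inj v ->
  finitely_supported inj (u + v).
Proof. by move=> [l ->] [m ->]; exists (l ++ m); rewrite big_cat. Qed.

Lemma finitely_supported_sum K F S (inj : forall k, mor (F k) S) (J : Type)
    (s : seq J) (u : J -> mor K S) :
  (forall j, finitely_supported inj (u j)) ->
  finitely_supported inj (\sum_(j <- s) u j).
Proof.
move=> uP; elim: s => [|j s IHs]; first by exists [::]; rewrite !big_nil.
by rewrite big_cons; apply: finitely_supportedD.
Qed.

Lemma finitely_supported_finite K F S (inj : forall k, mor (F k) S)
    (p : forall k, mor S (F k)) (u : mor K S) :
  (forall k, p k ∘ inj k = idm (F k)) ->
  (forall j k, j != k -> p j ∘ inj k = 0) ->
  finitely_supported inj u ->
  exists2 s : seq I, uniq s & u = (\sum_(k <- s) inj k ∘ p k) ∘ u.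
Proof.
move=> pinj pinj0 [l uE]; exists (undup (map tag l)); first exact: undup_uniq.
rewrite uE compm_sum; apply: eq_big_seq => x xl.
rewrite composeA; congr (_ ∘ _).
rewrite comp_summ (bigD1_seq (tag x)) ?undup_uniq ?mem_undup ?map_f //=.
rewrite -composeA pinj composem1 big1 ?addr0 // => k kx.
by rewrite -composeA pinj0 ?compm0.
Qed.

Lemma finitely_supported_comp K K' F S (inj : forall k, mor (F k) S)
    (u : mor K S) (v : mor K' K) :
  finitely_supported inj u -> finitely_supported inj (u ∘ v).
Proof.
move=> [l ->]; rewrite comp_summ; apply: finitely_supported_sum => x.
by rewrite -composeA; apply: finitely_supported_inj.
Qed.

Lemma finitely_supported_map K F F' S S' (inj : forall k, mor (F k) S)
    (inj' : forall k, mor (F' k) S') (p : forall k, mor (F k) (F' k))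
    (q : mor S S') (u : mor K S) :
  (forall k, q ∘ inj k = inj' k ∘ p k) ->
  finitely_supported inj u -> finitely_supported inj' (q ∘ u).
Proof.
move=> qE [l ->]; rewrite compm_sum; apply: finitely_supported_sum => x.
by rewrite composeA qE -composeA; apply: finitely_supported_inj.
Qed.

End Coproducts.

(** The components of a map to a coproduct are read off by the projections, so
    the uniqueness demanded by compactness is automatic. *)
Lemma finitely_supported_compact (C : preadditive) (K : C) :
  (forall (I : choiceType) (F : I -> C) (S : C) (inj : forall k, mor (F k) S),
     is_coproduct inj -> forall u : mor K S, finitely_supported inj u) <->
  compact K.
Proof.
split=> [fsK | cK] I F S inj injP u; last first.
  have [g [[s [_ _ ->]] _]] := cK I F S inj injP u.
  by apply: finitely_supported_sum => k; apply: finitely_supported_inj.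
have [p [pinj pinj0]] := coproduct_proj injP.
have [s s_uniq uE] := finitely_supported_finite pinj pinj0 (fsK I F S inj injP u).
exists (fun k => p k ∘ u); split.
  exists s; split=> // [k ks|]; last first.
    by rewrite {1}uE comp_summ; apply: eq_bigr => k _; rewrite composeA.
  rewrite uE composeA compm_sum big_seq big1 ?comp0m // => j js.
  by rewrite composeA pinj0 ?comp0m //; apply: contraNneq ks => ->.
move=> g [t [t_uniq gt0 ->]]; apply: functional_extensionality_dep => k.
rewrite compm_sum; have [kt | kt] := boolP (k \in t).
  rewrite (bigD1_seq k) //= composeA pinj compose1m big1 ?addr0 // => j jk.
  by rewrite composeA pinj0 ?comp0m // eq_sym.
rewrite (gt0 k kt) big_seq big1 // => j jt.
by rewrite composeA pinj0 ?comp0m //; apply: contraNneq kt => ->.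
Qed.

(** * Triangulated categories *)

Section Triangulated.
Variable C : triangulated.
Implicit Types X Y Z T : C.

Lemma susp_faithful X Y (u v : mor X Y) : fmap susp u = fmap susp v -> u = v.
Proof.
have [G [a [b [aE _]]]] := @susp_equiv C.
by move=> uv; apply: (iso_mono (e := a Y)); rewrite -!aE uv.
Qed.

Lemma susp_full X Y (w : mor (susp X) (susp Y)) : exists u, w = fmap susp u.
Proof.
have [G [a [b [aE bE]]]] := @susp_equiv C.
have G_faithful A B (u v : mor A B) : fmap G u = fmap G v -> u = v.
  by move=> uv; apply: (iso_epi (e := b A)); rewrite !bE uv.
exists (iinv (a Y) ∘ (fmap G w ∘ a X)); apply: G_faithful.
by apply: (iso_epi (e := a X)); rewrite aE composeA ifwdK compose1m.
Qed.

Lemma susp_surj X : exists Y : C, inhabited (iso (susp Y) X).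
Proof. by have [G [a [b _]]] := @susp_equiv C; exists (G X); split. Qed.

Lemma zero_obj : exists O : C, is_zero O.
Proof. by case: (tri_additive C). Qed.

Section Exactness.
Variables (X Y Z : C) (f : mor X Y) (g : mor Y Z) (h : mor Z (susp X)).
Hypothesis fgh : dist f g h.

Lemma dist_comp0 : g ∘ f = 0.
Proof.
have [O O0] := zero_obj.
have [c [cE _]] := dist_fill (a := idm X) (b := f) (dist_id X O0) fgh erefl.
by rewrite -cE compm0.
Qed.

(** Fill in a map to the triangle rotated once, from the rotation of the
    trivial triangle on [T]; the filler has to be desuspended. *)
Lemma dist_lift T (u : mor T Y) : g ∘ u = 0 -> exists v, u = f ∘ v.
Proof.
move=> gu0; have [O O0] := zero_obj.
have idT : dist (0 : mor T O) (0 : mor O (susp T)) (- fmap susp (idm T)).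
  exact: (proj1 (dist_rotate _ _ _) (dist_id _ _)).
have ghf : dist g h (- fmap susp f) by apply: (proj1 (dist_rotate _ _ _)).
have [|c [_]] := dist_fill (a := u) (b := 0 : mor O Z) idT ghf.
  by rewrite gu0 comp0m.
rewrite fmap1 compmN composem1 compNm => /oppr_inj.
have [v ->] := susp_full c; rewrite -fmapM => /susp_faithful uE.
by exists v.
Qed.

Lemma dist_extend T (u : mor Y T) : u ∘ f = 0 -> exists v, u = v ∘ g.
Proof.
move=> uf0; have [O O0] := zero_obj.
have sO0 : is_zero (susp O) by apply: additive_zero => //; apply: susp_additive.
have idT : dist (0 : mor O T) (idm T) (0 : mor T (susp O)).
  apply: (proj2 (dist_rotate _ _ _)).
  rewrite additive0 ?oppr0; last exact: susp_additive.
  exact: dist_id.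
have [|c [cE _]] := dist_fill (a := 0 : mor X O) (b := u) fgh idT.
  by rewrite uf0 comp0m.
by exists c; rewrite cE compose1m.
Qed.

End Exactness.

Lemma cone_iso_zero X Y Z (f : mor X Y) (g : mor Y Z) (h : mor Z (susp X)) :
  dist f g h -> is_iso f -> is_zero Z.
Proof.
move=> fgh /is_iso_iso[e fE].
have ghf : dist g h (- fmap susp f) by apply: (proj1 (dist_rotate _ _ _)).
have hfg : dist h (- fmap susp f) (- fmap susp g).
  by apply: (proj1 (dist_rotate _ _ _)).
have h0 : h = 0.
  have /eqP := dist_comp0 hfg; rewrite compNm oppr_eq0 => /eqP.
  rewrite fE -(compm0 _ (fmap_iso susp e)).
  exact: (iso_mono (e := fmap_iso susp e)).
have g0 : g = 0.
  apply: (iso_epi (e := e)); rewrite -fE comp0m; exact: dist_comp0 fgh.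
have [|v vE] := dist_lift ghf (u := idm Z); first by rewrite h0 comp0m.
by rewrite /is_zero vE g0 comp0m.
Qed.

Lemma cone_zero_iso X Y Z (f : mor X Y) (g : mor Y Z) (h : mor Z (susp X)) :
  dist f g h -> is_zero Z -> is_iso f.
Proof.
move=> fgh Z0.
have ghf : dist g h (- fmap susp f) by apply: (proj1 (dist_rotate _ _ _)).
have hfg : dist h (- fmap susp f) (- fmap susp g).
  by apply: (proj1 (dist_rotate _ _ _)).
have f_mono T (u : mor T X) : f ∘ u = 0 -> u = 0.
  move=> fu0; apply: susp_faithful; rewrite additive0; last exact: susp_additive.
  have [|w ->] := dist_lift hfg (u := fmap susp u); last first.
    by rewrite (mor_from_zero h Z0) comp0m.
  by rewrite compNm -fmapM fu0 additive0 ?oppr0 //; apply: susp_additive.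
have [|v vE] := dist_lift fgh (u := idm Y); first exact: mor_to_zero.
exists v; split=> //; apply/eqP; rewrite -subr_eq0; apply/eqP/f_mono.
by rewrite compmB composeA -vE compose1m composem1 subrr.
Qed.

End Triangulated.

(** * Closed symmetric monoidal triangulated categories *)

Section Monoidal.
Variable C : csm_triangulated.
Implicit Types A B E N M T X Y Z : C.

Lemma tensm_compl A A' A'' B (f' : mor A' A'') (f : mor A A') :
  (f' ∘ f) ⊠ idm B = (f' ⊠ idm B) ∘ (f ⊠ idm B).
Proof. by rewrite -tensmM compose1m. Qed.

Lemma tensm_compr A B B' B'' (g' : mor B' B'') (g : mor B B') :
  idm A ⊠ (g' ∘ g) = (idm A ⊠ g') ∘ (idm A ⊠ g).
Proof. by rewrite -tensmM compose1m. Qed.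

Lemma tensm_splitr A A' B B' (f : mor A A') (g : mor B B') :
  (f ⊠ idm B') ∘ (idm A ⊠ g) = f ⊠ g.
Proof. by rewrite -tensmM compose1m composem1. Qed.

Lemma tensm_splitl A A' B B' (f : mor A A') (g : mor B B') :
  (idm A' ⊠ g) ∘ (f ⊠ idm B) = f ⊠ g.
Proof. by rewrite -tensmM compose1m composem1. Qed.

Lemma tensm0l A A' B B' (g : mor B B') : (0 : mor A A') ⊠ g = 0.
Proof.
by apply: (addrI ((0 : mor A A') ⊠ g)); rewrite -tensmDl !addr0.
Qed.

Lemma tensm0r A A' B B' (f : mor A A') : f ⊠ (0 : mor B B') = 0.
Proof.
by apply: (addrI (f ⊠ (0 : mor B B'))); rewrite -tensmDr !addr0.
Qed.

Lemma tens_zerol A B : is_zero A -> is_zero (A ⊗ B).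
Proof. by move=> A0; rewrite /is_zero -tensm1 A0 tensm0l. Qed.

Lemma tens_zeror A B : is_zero B -> is_zero (A ⊗ B).
Proof. by move=> B0; rewrite /is_zero -tensm1 B0 tensm0r. Qed.

Definition tens_iso A A' B B' (e : iso A A') (d : iso B B') :
  iso (A ⊗ B) (A' ⊗ B').
Proof.
by exists (e ⊠ d) (iinv e ⊠ iinv d); rewrite -tensmM ?iinvK ?ifwdK tensm1.
Defined.

Lemma tensm_is_iso A A' B B' (f : mor A A') (g : mor B B') :
  is_iso f -> is_iso g -> is_iso (f ⊠ g).
Proof.
move=> /is_iso_iso[e ->] /is_iso_iso[d ->].
exact: (iso_is_iso (tens_iso e d)).
Qed.

Lemma id_is_iso A : is_iso (idm A).
Proof. exact: (iso_is_iso (id_iso A)). Qed.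

(** Kelly's argument: both sides become equal after tensoring on the left with
    the unit, which is a faithful operation, by the pentagon and two instances
    of the triangle. *)
Lemma lunit_tens A B : lunit (A ⊗ B) ∘ assoc tunit A B = lunit A ⊠ idm B.
Proof.
have tunit_faithful X Y (f g : mor X Y) :
    idm tunit ⊠ f = idm tunit ⊠ g -> f = g.
  by move=> fg; apply: (iso_epi (e := lunit X)); rewrite !lunit_nat fg.
apply: tunit_faithful; rewrite tensm_compr.
apply: (iso_epi (e := assoc tunit (tunit ⊗ A) B)).
apply: (iso_epi (e := tens_iso (assoc tunit tunit A) (id_iso B))).
rewrite /= assoc_nat -!composeA.
rewrite [(idm tunit ⊠ assoc tunit A B) ∘ _]composeA -pentagon composeA.
rewrite unit_triangle -tensm1 -tensm_compl unit_triangle.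
by rewrite -assoc_nat.
Qed.

Lemma curry_inj T A B (u v : mor T (ihom A B)) :
  eval A B ∘ (u ⊠ idm A) = eval A B ∘ (v ⊠ idm A) -> u = v.
Proof. by move=> uv; rewrite -[u]curry_eval uv curry_eval. Qed.

Lemma tens_coproduct (I : choiceType) (F : I -> C) S
    (inj : forall k, mor (F k) S) A :
  is_coproduct inj -> is_coproduct (fun k => inj k ⊠ idm A).
Proof.
move=> injP T g; have [u [uE uU]] := injP (ihom A T) (fun k => curry (g k)).
exists (eval A T ∘ (u ⊠ idm A)); split=> [k|v vE].
  by rewrite -composeA -tensm_compl uE eval_curry.
rewrite (uU (curry v)) ?eval_curry // => k; apply: curry_inj.
by rewrite tensm_compl composeA !eval_curry.
Qed.

Lemma tens_coproductr (I : choiceType) (F : I -> C) S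
    (inj : forall k, mor (F k) S) A :
  is_coproduct inj -> is_coproduct (fun k => idm A ⊠ inj k).
Proof.
move=> /(@tens_coproduct _ _ _ _ A) injP.
apply: (coproduct_transport (p := fun k => braid (F k) A) (q := braid S A) injP).
by move=> k; rewrite braid_nat.
Qed.

(** ** Rigid objects *)

(** The counit of the adjunction between tensoring with [M] and tensoring with
    its dual, when [M] is rigid. *)
Definition dual_pairing M N : mor (N ⊗ tt_dual M ⊗ M) N :=
  runit N ∘ (idm N ⊠ eval M tunit) ∘ assoc N (tt_dual M) M.

Lemma dual_pairing_nat M N N' (u : mor N N') :
  u ∘ dual_pairing M N
  = dual_pairing M N' ∘ ((u ⊠ idm (tt_dual M)) ⊠ idm M).
Proof.
rewrite /dual_pairing !composeA runit_nat -!composeA -assoc_nat tensm1.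
rewrite [in RHS](composeA (_ ⊠ eval M tunit)) tensm_splitl.
by rewrite [in LHS](composeA (u ⊠ _)) tensm_splitr.
Qed.

Lemma dual_pairing_ihom M N :
  eval M N ∘ ((dual_tens_to_ihom M N ∘ braid N (tt_dual M)) ⊠ idm M)
  = dual_pairing M N.
Proof.
rewrite tensm_compl composeA eval_curry -composeA -tensm_compl braidK tensm1.
by rewrite composem1.
Qed.

Section Rigid.
Variable M : C.
Hypothesis rM : rigid M.

Definition dual_transpose T N (q : mor (T ⊗ M) N) : mor T (N ⊗ tt_dual M) :=
  iinv (iso_trans (braid N (tt_dual M)) (iso_of (rM N))) ∘ curry q.

Lemma dual_transposeK T N (q : mor (T ⊗ M) N) :
  dual_pairing M N ∘ (dual_transpose q ⊠ idm M) = q.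
Proof.
rewrite -dual_pairing_ihom -composeA -tensm_compl /dual_transpose.
set e := iso_trans _ _.
have -> : dual_tens_to_ihom M N ∘ braid N (tt_dual M) = e by rewrite /= iso_ofE.
by rewrite composeA ifwdK compose1m eval_curry.
Qed.

Lemma dual_transpose_inj T N (u v : mor T (N ⊗ tt_dual M)) :
  dual_pairing M N ∘ (u ⊠ idm M) = dual_pairing M N ∘ (v ⊠ idm M) -> u = v.
Proof.
pose e := iso_trans (braid N (tt_dual M)) (iso_of (rM N)).
have eE : dual_tens_to_ihom M N ∘ braid N (tt_dual M) = e by rewrite /= iso_ofE.
move=> uv; apply: (iso_mono (e := e)); rewrite -eE; apply: curry_inj.
by rewrite tensm_compl (tensm_compl _ _ v) !composeA dual_pairing_ihom.
Qed.

Lemma dual_transpose_nat T N N' (q : mor (T ⊗ M) N) (u : mor N N') :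
  dual_transpose (u ∘ q) = (u ⊠ idm (tt_dual M)) ∘ dual_transpose q.
Proof.
apply: dual_transpose_inj; rewrite dual_transposeK tensm_compl composeA.
by rewrite -dual_pairing_nat -composeA dual_transposeK.
Qed.

Definition coev : mor tunit (M ⊗ tt_dual M) := dual_transpose (lunit M).

Lemma coev_triangle :
  runit M ∘ (idm M ⊠ eval M tunit) ∘ assoc M (tt_dual M) M ∘ (coev ⊠ idm M)
  = lunit M.
Proof. exact: dual_transposeK. Qed.

(** This is the triangle identity for the adjunction of [dual_transpose]: the
    section is its unit at [N ⊗ DM], the retraction is the counit tensored
    with [DM]. *)
Lemma tens_dual_retract N :
  exists (s : mor (N ⊗ tt_dual M) (N ⊗ tt_dual M ⊗ M ⊗ tt_dual M))
         (r : mor (N ⊗ tt_dual M ⊗ M ⊗ tt_dual M) (N ⊗ tt_dual M)),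
    r ∘ s = idm (N ⊗ tt_dual M).
Proof.
exists (dual_transpose (idm _)), (dual_pairing M N ⊠ idm (tt_dual M)).
rewrite -dual_transpose_nat composem1; apply: dual_transpose_inj.
by rewrite dual_transposeK tensm1 composem1.
Qed.

End Rigid.

(** A map out of [X ⊗ 1] amounts to a map out of [X], so maps into [ihom 1 N]
    amount to maps into [N]. *)
Lemma curry_unit_iso X N (q : mor (X ⊗ tunit) N) : is_iso q -> is_iso (curry q).
Proof.
move=> /is_iso_iso[e qE].
pose w := runit X ∘ iinv e ∘ eval tunit N ∘ iinv (runit (ihom tunit N)).
have wE : w ∘ runit _ = runit X ∘ iinv e ∘ eval tunit N.
  by rewrite /w -composeA iinvK composem1.
exists w; split.
  apply: (iso_epi (e := runit X)).
  rewrite compose1m -composeA runit_nat composeA wE -composeA eval_curry qE.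
  by rewrite -composeA iinvK composem1.
apply: curry_inj; rewrite tensm1 composem1 tensm_compl composeA eval_curry.
apply: (iso_mono (e := iso_trans (iso_sym e) (runit X))).
rewrite /= -wE runit_nat.
by rewrite qE -!composeA [iinv e ∘ _]composeA iinvK compose1m.
Qed.

Lemma rigid_unit : rigid (tunit : C).
Proof.
move=> N; apply: curry_unit_iso.
have ev_iso : is_iso (eval (tunit : C) tunit).
  have : is_iso (curry (runit (tunit : C))) by apply/curry_unit_iso/iso_is_iso.
  move=> cI; apply: (is_iso_compr (f := curry (runit tunit) ⊠ idm tunit)).
    exact: tensm_is_iso cI (id_is_iso _).
  by rewrite eval_curry; apply: iso_is_iso.
apply: is_iso_comp; last exact: tensm_is_iso (iso_is_iso _) (id_is_iso _).
apply: is_iso_comp; last exact: iso_is_iso.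
apply: is_iso_comp; first exact: iso_is_iso.
exact: tensm_is_iso (id_is_iso _) ev_iso.
Qed.

End Monoidal.

(** * Actions of a tensor category and lax module functors *)

(** A left module category over [C], with underlying category [A]. *)
Record action (C : csm_triangulated) (A : preadditive) := Action {
  act :> C -> A -> A;
  actm : forall (N N' : C) (x x' : A),
    mor N N' -> mor x x' -> mor (act N x) (act N' x');
  actm1 : forall N x, actm (idm N) (idm x) = idm (act N x);
  actmM : forall (N N' N'' : C) (x x' x'' : A)
      (n' : mor N' N'') (n : mor N N') (g' : mor x' x'') (g : mor x x'),
    actm (n' ∘ n) (g' ∘ g) = actm n' g' ∘ actm n g;
  act_assoc : forall N N' x, iso (act (N ⊗ N') x) (act N (act N' x));
  act_unit : forall x, iso (act tunit x) x;
  act_assoc_nat : forall (N1 N1' N2 N2' : C) (x x' : A)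
      (n1 : mor N1 N1') (n2 : mor N2 N2') (g : mor x x'),
    actm n1 (actm n2 g) ∘ act_assoc N1 N2 x
    = act_assoc N1' N2' x' ∘ actm (n1 ⊠ n2) g;
  act_unit_nat : forall (x x' : A) (g : mor x x'),
    g ∘ act_unit x = act_unit x' ∘ actm (idm tunit) g;
  act_pentagon : forall (N1 N2 N3 : C) (x : A),
    act_assoc N1 N2 (act N3 x) ∘ act_assoc (N1 ⊗ N2) N3 x
    = actm (idm N1) (act_assoc N2 N3 x) ∘ act_assoc N1 (N2 ⊗ N3) x
      ∘ actm (assoc N1 N2 N3) (idm x);
  act_triangler : forall N x,
    actm (idm N) (act_unit x) ∘ act_assoc N tunit x
    = actm (runit N) (idm x);
  act_trianglel : forall N x,
    act_unit (act N x) ∘ act_assoc tunit N x = actm (lunit N) (idm x)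
}.

Definition self_action (C : csm_triangulated) : action C C.
Proof.
exists (@tens C) (@tensm C) (@assoc C) (@lunit C).
- exact: tensm1.
- by move=> *; rewrite tensmM.
- exact: assoc_nat.
- exact: lunit_nat.
- exact: pentagon.
- exact: unit_triangle.
- exact: lunit_tens.
Defined.

Section Action.
Variables (C : csm_triangulated) (A : preadditive) (a : action C A).

Lemma actm_compr N (x x' x'' : A) (g' : mor x' x'') (g : mor x x') :
  actm a (idm N) (g' ∘ g) = actm a (idm N) g' ∘ actm a (idm N) g.
Proof. by rewrite -actmM compose1m. Qed.

Lemma actm_compl N N' N'' (x : A) (n' : mor N' N'') (n : mor N N') :
  actm a (n' ∘ n) (idm x) = actm a n' (idm x) ∘ actm a n (idm x).
Proof. by rewrite -actmM compose1m. Qed.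

Lemma actm_interchange N N' (x x' : A) (n : mor N N') (g : mor x x') :
  actm a (idm N') g ∘ actm a n (idm x) = actm a n (idm x') ∘ actm a (idm N) g.
Proof. by rewrite -!actmM !compose1m !composem1. Qed.

(** ** The action of a rigid object and of its dual *)

Variables (N : C) (rN : rigid N).

Definition act_ev (x : A) : mor (a (tt_dual N) (a N x)) x :=
  act_unit a x ∘ actm a (eval N tunit) (idm x)
  ∘ iinv (act_assoc a (tt_dual N) N x).

Definition act_coev (x : A) : mor x (a N (a (tt_dual N) x)) :=
  act_assoc a N (tt_dual N) x ∘ actm a (coev rN) (idm x)
  ∘ iinv (act_unit a x).

Lemma act_coev_nat (x x' : A) (g : mor x x') :
  actm a (idm N) (actm a (idm (tt_dual N)) g) ∘ act_coev x = act_coev x' ∘ g.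
Proof.
apply: (iso_epi (e := act_unit a x)).
rewrite /act_coev !composeA (comp_under _ (iinvK _)) composem1.
rewrite act_assoc_nat tensm1 -[LHS]composeA actm_interchange !composeA.
rewrite -[RHS]composeA act_unit_nat !composeA (comp_under _ (iinvK _)).
by rewrite composem1.
Qed.

(** By the pentagon and the two triangles of the action, this is the image of
    [coev_triangle] under the action on [x]. *)
Lemma act_triangle (x : A) :
  actm a (idm N) (act_ev x) ∘ act_coev (a N x) = idm (a N x).
Proof.
apply: (iso_epi (e := act_unit a (a N x))).
apply: (iso_epi (e := act_assoc a tunit N x)).
rewrite compose1m act_trianglel /act_coev /act_ev.
rewrite !composeA (comp_under _ (iinvK _)) composem1 !actm_compr.
rewrite -(actm1 a N x) -(composeA _ (actm a (coev rN) _)) act_assoc_nat.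
rewrite !composeA -(composeA _ _ (act_assoc a (N ⊗ tt_dual N) N x)).
rewrite act_pentagon !composeA.
rewrite -(composeA _ (actm a (idm N) (iinv _))) -(actm_compr _ (iinv _)) iinvK.
rewrite actm1 composem1.
rewrite -(composeA _ _ (act_assoc a N _ _)) act_assoc_nat !composeA act_triangler.
by rewrite -!actm_compl coev_triangle.
Qed.

End Action.

(** ** Lax module functors *)

Record lax_module (C : csm_triangulated) (A B : preadditive) (a : action C A)
    (b : action C B) (G : functor A B) := LaxModule {
  lax :> forall (N : C) (x : A), mor (b N (G x)) (G (a N x));
  lax_nat : forall (N N' : C) (x x' : A) (n : mor N N') (g : mor x x'),
    fmap G (actm a n g) ∘ lax N x = lax N' x' ∘ actm b n (fmap G g);
  lax_assoc : forall (N N' : C) (x : A),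
    fmap G (act_assoc a N N' x) ∘ lax (N ⊗ N') x
    = lax N (a N' x) ∘ actm b (idm N) (lax N' x) ∘ act_assoc b N N' (G x);
  lax_unit : forall x : A,
    fmap G (act_unit a x) ∘ lax tunit x = act_unit b (G x)
}.

Section LaxModule.
Variables (C : csm_triangulated) (A B : preadditive).
Variables (a : action C A) (b : action C B) (G : functor A B).
Variable l : lax_module a b G.

Lemma lax_tens_iso N N' x : is_iso (l N (a N' x)) -> is_iso (l N' x) ->
  is_iso (l (N ⊗ N') x).
Proof.
move=> lN /is_iso_iso[e eE].
apply: (is_iso_compl (g := fmap G (act_assoc a N N' x))).
  exact: fmap_is_iso (iso_is_iso _).
rewrite lax_assoc eE; apply: is_iso_comp (iso_is_iso _).
apply: is_iso_comp lN _; exists (actm b (idm N) (iinv e)).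
by rewrite -!actmM !compose1m iinvK ifwdK !actm1.
Qed.

(** For [N] and [N ⊗ N'] rigid but [N'] arbitrary, this makes the comparison map
    of [N'] invertible after acting by [N]. *)
Lemma lax_isor N N' x : is_iso (l (N ⊗ N') x) -> is_iso (l N (a N' x)) ->
  is_iso (actm b (idm N) (l N' x)).
Proof.
move=> lNN' lN; apply: (is_iso_compl lN).
apply: (is_iso_compr (f := act_assoc b N N' (G x))); first exact: iso_is_iso.
rewrite -lax_assoc; apply: is_iso_comp lNN'.
exact: fmap_is_iso (iso_is_iso _).
Qed.

Section Rigid.
Variables (N : C) (rN : rigid N).

Lemma lax_ev x :
  fmap G (act_ev a N x) ∘ l (tt_dual N) (a N x)
    ∘ actm b (idm (tt_dual N)) (l N x)
  = act_ev b N (G x).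
Proof.
apply: (iso_epi (e := act_assoc b (tt_dual N) N (G x))).
rewrite -(composeA _ (actm b _ _)) -(composeA _ (l _ _)) [l _ _ ∘ _]composeA.
rewrite -lax_assoc composeA -fmapM /act_ev -!(composeA (_ ∘ _)) !iinvK.
by rewrite !composem1 fmapM -composeA lax_nat composeA lax_unit fmap1.
Qed.

Lemma lax_coev x :
  l N (a (tt_dual N) x) ∘ actm b (idm N) (l (tt_dual N) x) ∘ act_coev b rN (G x)
  = fmap G (act_coev a rN x).
Proof.
apply: (iso_epi (e := act_unit b (G x))).
rewrite /act_coev !composeA (comp_under _ (iinvK _)) composem1 -lax_assoc.
rewrite -(lax_unit l) !composeA -fmapM (comp_under _ (iinvK _)) composem1.
by rewrite fmapM -!composeA lax_nat fmap1.
Qed.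

(** The inverse inserts the coevaluation of [N] and then moves the dual of [N]
    inside [G], where it cancels the copy of [N] already there. *)
Theorem lax_rigid_iso x : is_iso (l N x).
Proof.
exists (actm b (idm N) (fmap G (act_ev a N x) ∘ l (tt_dual N) (a N x))
        ∘ act_coev b rN (G (a N x))); split.
  rewrite -composeA -act_coev_nat composeA -actm_compr lax_ev.
  exact: act_triangle.
rewrite actm_compr -composeA [LHS]composeA -lax_nat -composeA.
rewrite [l N _ ∘ _]composeA lax_coev.
by rewrite -fmapM act_triangle fmap1.
Qed.

End Rigid.
End LaxModule.

(** Doctrinal adjunction: the comparison map is the mate of the inverse of the
    comparison map of the left adjoint. *)
Section Doctrinal.
Variables (C : csm_triangulated) (A B : preadditive).
Variables (a : action C A) (b : action C B).
Variables (F : functor A B) (G : functor B A) (adj : adjunction F G).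
Variables (l : lax_module a b F).
Hypothesis strong : forall N x, is_iso (l N x).

Definition right_adjoint_lax_map (N : C) (y : B) : mor (a N (G y)) (G (b N y)) :=
  transpose adj
    (actm b (idm N) (counit_adj adj y) ∘ iinv (iso_of (strong N (G y)))).

Lemma right_adjoint_lax_mapE N y :
  counit_adj adj (b N y) ∘ fmap F (right_adjoint_lax_map N y) ∘ l N (G y)
  = actm b (idm N) (counit_adj adj y).
Proof.
by rewrite transposeK -composeA iso_ofK composem1.
Qed.

Lemma right_adjoint_ext N x (y : B) (u v : mor (a N x) (G y)) :
  counit_adj adj y ∘ fmap F u ∘ l N x = counit_adj adj y ∘ fmap F v ∘ l N x ->
  u = v.
Proof.
move=> uv; apply: (transpose_inj (adj := adj)).
apply: (iso_epi (e := iso_of (strong N x))).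
by rewrite iso_ofE.
Qed.

Definition right_adjoint_lax : lax_module b a G.
Proof.
move: right_adjoint_lax_map right_adjoint_lax_mapE => p pE; exists p.
- move=> N N' y y' n g; apply: right_adjoint_ext.
  rewrite !fmapM !composeA -counit_adj_nat -2!composeA [_ ∘ (_ ∘ l _ _)]composeA.
  rewrite pE -composeA lax_nat composeA pE.
  by rewrite -!actmM !compose1m composem1 counit_adj_nat.
- move=> N N' y; apply: right_adjoint_ext.
  rewrite !fmapM !composeA -counit_adj_nat -2!composeA [_ ∘ (_ ∘ l _ _)]composeA.
  rewrite pE -!composeA lax_assoc.
  rewrite [fmap F (actm _ _ _) ∘ _]composeA [fmap F (actm _ _ _) ∘ _]composeA.
  by rewrite lax_nat !composeA pE -!actm_compr pE act_assoc_nat tensm1.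
- move=> y; apply: right_adjoint_ext.
  rewrite !fmapM !composeA -counit_adj_nat -2!composeA [_ ∘ (_ ∘ l _ _)]composeA.
  by rewrite pE -composeA lax_unit act_unit_nat.
Qed.

End Doctrinal.

(** ** The action along a strong monoidal functor *)

Section Pullback.
Variables (C D : csm_triangulated) (F : functor C D) (sm : strong_monoidal F).

Lemma iinv_sm_tens_nat (A A' B B' : C) (u : mor A A') (v : mor B B') :
  iinv (sm_tens sm A' B') ∘ fmap F (u ⊠ v)
  = (fmap F u ⊠ fmap F v) ∘ iinv (sm_tens sm A B).
Proof. by apply: iso_inv_nat; rewrite sm_nat. Qed.

Lemma iinv_sm_assoc (N1 N2 N3 : C) :
  assoc (F N1) (F N2) (F N3) ∘ (iinv (sm_tens sm N1 N2) ⊠ idm (F N3))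
    ∘ iinv (sm_tens sm (N1 ⊗ N2) N3)
  = (idm (F N1) ⊠ iinv (sm_tens sm N2 N3)) ∘ iinv (sm_tens sm N1 (N2 ⊗ N3))
    ∘ fmap F (assoc N1 N2 N3).
Proof.
apply: (iso_epi (e := sm_tens sm (N1 ⊗ N2) N3)).
apply: (iso_epi (e := tens_iso (sm_tens sm N1 N2) (id_iso (F N3)))).
rewrite !(comp_under _ (iinvK _)) !composem1 /=.
rewrite -(composeA _ (_ ⊠ _)) -tensm_compl iinvK tensm1 composem1.
rewrite -!(composeA (_ ∘ _)) [fmap F _ ∘ (_ ∘ _)]composeA sm_assoc.
rewrite !composeA (comp_under _ (iinvK _)) composem1.
by rewrite -tensm_compr iinvK tensm1 compose1m.
Qed.

Definition pullback_action : action C D.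
Proof.
exists (fun N y => F N ⊗ y) (fun N N' y y' n g => fmap F n ⊠ g)
  (fun N N' y => iso_trans
     (tens_iso (iso_sym (sm_tens sm N N')) (id_iso y)) (assoc (F N) (F N') y))
  (fun y => iso_trans
     (tens_iso (iso_sym (sm_unit sm)) (id_iso y)) (lunit y)) => /=.
- by move=> N y; rewrite fmap1 tensm1.
- by move=> *; rewrite fmapM tensmM.
- move=> N1 N1' N2 N2' y y' n1 n2 g; rewrite composeA assoc_nat -!composeA.
  by rewrite -!tensmM iinv_sm_tens_nat compose1m composem1.
- move=> y y' g; rewrite composeA lunit_nat -!composeA fmap1.
  by rewrite tensm_splitl tensm_splitr.
- move=> N1 N2 N3 y; rewrite fmap1 tensm_compr.
  have E := assoc_nat (iinv (sm_tens sm N1 N2)) (idm (F N3)) (idm y).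
  rewrite tensm1 in E; rewrite !composeA -(composeA _ _ (assoc _ _ _)) E.
  rewrite !composeA pentagon.
  have E' := assoc_nat (idm (F N1)) (iinv (sm_tens sm N2 N3)) (idm y).
  rewrite -[in RHS](composeA _ (_ ⊠ _) (assoc _ _ _)) E'.
  rewrite -!(composeA (_ ∘ assoc _ _ _)) -!composeA; congr (_ ∘ (_ ∘ _)).
  by rewrite -!tensm_compl composeA iinv_sm_assoc composeA.
- move=> N y; rewrite fmap1 tensm_compr.
  have E := assoc_nat (idm (F N)) (iinv (sm_unit sm)) (idm y).
  rewrite -!(composeA (_ ⊠ lunit y)) [(_ ⊠ _) ∘ (assoc _ _ _ ∘ _)]composeA E.
  rewrite !composeA unit_triangle -!tensm_compl; congr (_ ⊠ _).
  apply: (iso_epi (e := sm_tens sm N tunit)).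
  rewrite (comp_under _ (iinvK _)) composem1 -(sm_runit sm N).
  by rewrite -!composeA -tensm_compr ifwdK tensm1 composem1.
- move=> N y.
  have E := assoc_nat (iinv (sm_unit sm)) (idm (F N)) (idm y).
  rewrite tensm1 in E; rewrite composeA -(composeA _ _ (assoc _ _ _)) E.
  rewrite !composeA lunit_tens -!tensm_compl; congr (_ ⊠ _).
  apply: (iso_epi (e := sm_tens sm tunit N)).
  rewrite (comp_under _ (iinvK _)) composem1 -(sm_lunit sm N).
  by rewrite -!composeA -tensm_compl ifwdK tensm1 composem1.
Defined.

Definition strong_monoidal_lax : lax_module (self_action C) pullback_action F.
Proof.
exists (fun N x => ifwd (sm_tens sm N x)) => /=.
- by move=> *; rewrite sm_nat.
- move=> N N' x.
  apply: (iso_epi (e := tens_iso (sm_tens sm N N') (id_iso (F x)))).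
  rewrite /= sm_assoc !composeA fmap1 -[RHS]composeA -tensm_compl.
  by rewrite iinvK tensm1 composem1.
- move=> x; rewrite -(sm_lunit sm x) -!composeA -tensm_compl ifwdK tensm1.
  by rewrite composem1.
Defined.

End Pullback.

(** * Tensor triangulated categories *)

Lemma finitely_supported_fmap (C D : preadditive) (F : functor C D)
    (I : choiceType) (X : I -> C) (K S : C) (inj : forall k, mor (X k) S)
    (u : mor K S) :
  additive_functor F -> finitely_supported inj u ->
  finitely_supported (fun k => fmap F (inj k)) (fmap F u).
Proof.
move=> addF [l ->]; elim: l => [|x l IHl].
  by exists [::]; rewrite !big_nil additive0.
rewrite big_cons addF; apply: finitely_supportedD IHl.
by rewrite fmapM; apply: (finitely_supported_inj (fun k => fmap F (inj k))).
Qed.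

Lemma finitely_supported_desusp (C : triangulated) (I : choiceType)
    (X : I -> C) (K S : C) (inj : forall k, mor (X k) S) (u : mor K S) :
  finitely_supported (fun k => fmap susp (inj k)) (fmap susp u) ->
  finitely_supported inj u.
Proof.
suff H v : finitely_supported (fun k => fmap susp (inj k)) v ->
    exists2 w : mor K S, v = fmap susp w & finitely_supported inj w.
  by case/H=> w /susp_faithful->.
case=> l ->; elim: l => [|[k g] l [w wE fw]].
  exists 0; last by exists [::]; rewrite big_nil.
  by rewrite big_nil additive0 //; apply: susp_additive.
have [g' /= ->] := susp_full g; exists (inj k ∘ g' + w).
  by rewrite big_cons /= wE susp_additive fmapM.
exact: finitely_supportedD (finitely_supported_inj _ _) fw.
Qed.

Section TT.
Variable C : ttCategory.
Implicit Types X Y Z W T N M K S : C.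

Definition tens_functor W : functor C C.
Proof.
exists (fun X => X ⊗ W) (fun X Y f => f ⊠ idm W) => *.
- exact: tensm1.
- exact: tensm_compl.
Defined.

Lemma tens_exact X Y Z W (f : mor X Y) (g : mor Y Z) (h : mor Z (susp X))
    T (u : mor T (Y ⊗ W)) :
  dist f g h -> (g ⊠ idm W) ∘ u = 0 -> exists v, u = (f ⊠ idm W) ∘ v.
Proof. by move=> fgh; apply: (dist_lift (tt_tens_dist W fgh)). Qed.

Definition unit_susp_tens X : iso (susp tunit ⊗ X) (susp X) :=
  iso_trans (tens_susp tunit X) (fmap_iso susp (lunit X)).

Lemma unit_susp_tens_nat X Y (u : mor X Y) :
  fmap susp u ∘ unit_susp_tens X = unit_susp_tens Y ∘ (idm (susp tunit) ⊠ u).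
Proof.
rewrite /= -(fmap1 susp) -composeA -tens_susp_nat !composeA -!fmapM.
by rewrite lunit_nat.
Qed.

Section Desuspension.
Variables (U : C) (e : iso (susp U) tunit).

Definition desusp_tens X : iso (susp (U ⊗ X)) X :=
  iso_trans (iso_sym (tens_susp U X))
    (iso_trans (tens_iso e (id_iso X)) (lunit X)).

Lemma desusp_tens_nat X Y (u : mor X Y) :
  u ∘ desusp_tens X = desusp_tens Y ∘ fmap susp (idm U ⊠ u).
Proof.
rewrite /= !composeA lunit_nat -!(composeA (lunit Y)).
congr (_ ∘ _).
apply: (iso_epi (e := tens_susp U X)).
rewrite -!composeA tens_susp_nat iinvK composem1 [iinv _ ∘ _]composeA iinvK.
by rewrite compose1m fmap1 tensm_splitl tensm_splitr.
Qed.

Definition desusp_cancel X : iso (U ⊗ susp X) X :=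
  iso_trans (braid U (susp X)) (iso_trans (tens_susp X U)
    (iso_trans (fmap_iso susp (braid X U)) (desusp_tens X))).

End Desuspension.

Hypothesis hC : rigidly_compactly_generated C.

Lemma rigid_fs M (I : choiceType) (F : I -> C) S (inj : forall k, mor (F k) S) :
  rigid M -> is_coproduct inj -> forall u : mor M S, finitely_supported inj u.
Proof. by move=> /(proj2 hC M)/finitely_supported_compact fsM /fsM. Qed.

Lemma fs_rigid M :
  (forall (I : choiceType) (F : I -> C) S (inj : forall k, mor (F k) S),
     is_coproduct inj -> forall u : mor M S, finitely_supported inj u) ->
  rigid M.
Proof. by move=> ?; apply/(proj2 hC M)/finitely_supported_compact. Qed.

(** A map from [Σ1] to [S ≅ Σ(U ⊗ S)], with [ΣU ≅ 1], desuspends to a map from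
    the compact object [1] to the coproduct [U ⊗ S]. *)
Lemma rigid_susp_unit : rigid (susp (tunit : C)).
Proof.
apply: fs_rigid => I F S inj injP u.
have [U [e]] := susp_surj (tunit : C).
have [w wE] := susp_full (iinv (desusp_tens e S) ∘ u).
have -> : u = desusp_tens e S ∘ fmap susp w.
  by rewrite -wE composeA ifwdK compose1m.
apply: (finitely_supported_map (p := fun k => desusp_tens e (F k))
  (inj := fun k => fmap susp (idm U ⊠ inj k))).
  by move=> k; rewrite desusp_tens_nat.
apply: (finitely_supported_fmap (inj := fun k => idm U ⊠ inj k)).
  exact: susp_additive.
exact: rigid_fs (@rigid_unit C) (tens_coproductr injP) _.
Qed.

(** The suspension of a map from [U] to [S] is a map from [ΣU ≅ 1] to the
    coproduct [Σ1 ⊗ S]. *)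
Lemma rigid_desusp_unit (U : C) : iso (susp U) tunit -> rigid U.
Proof.
move=> e; apply: fs_rigid => I F S inj injP u; apply: finitely_supported_desusp.
have -> : fmap susp u = unit_susp_tens S
    ∘ (iinv (unit_susp_tens S) ∘ fmap susp u ∘ iinv e) ∘ e.
  move: (unit_susp_tens S) => d.
  by rewrite !composeA ifwdK compose1m -composeA iinvK composem1.
apply: finitely_supported_comp.
apply: (finitely_supported_map (p := fun k => unit_susp_tens (F k))
  (inj := fun k => idm (susp tunit) ⊠ inj k)).
  by move=> k; rewrite unit_susp_tens_nat.
exact: rigid_fs (@rigid_unit C) (tens_coproductr injP) _.
Qed.

(** Shifting is tensoring with [Σ1] or with its inverse, which are rigid. Seen
    in this way, closure under shifts asks nothing about how the suspension
    comparison of a geometric functor interacts with its monoidal structure. *)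
Lemma tens_triangulated_sub (P : C -> Prop) :
  (forall X, is_zero X -> P X) -> (forall X Y, iso X Y -> P X -> P Y) ->
  (forall R X, rigid R -> P X -> P (R ⊗ X)) ->
  (forall X Y Z (f : mor X Y) (g : mor Y Z) (h : mor Z (susp X)),
     dist f g h -> P X -> P Y -> P (susp X) -> P (susp Y) -> P Z) ->
  is_triangulated_sub P.
Proof.
move=> P0 P_iso P_tens P_cone.
have P_susp X : P X -> P (susp X).
  by move=> PX; apply: P_iso (unit_susp_tens X) (P_tens _ _ rigid_susp_unit PX).
split=> // [X | X Y Z f g h fgh PX PY].
  split=> [|PX]; first exact: P_susp.
  have [U [e]] := susp_surj (tunit : C).
  exact: P_iso (desusp_cancel e X) (P_tens _ _ (rigid_desusp_unit e) PX).
by apply: (P_cone _ _ _ _ _ _ fgh) => //; apply: P_susp.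
Qed.

(** For [B] the unit this is compactness of [M]; for [B] rigid it will give
    compactness of [B ⊗ M]. *)
Definition relatively_compact M (B : C) : Prop :=
  forall (I : choiceType) (F : I -> C) S (inj : forall k, mor (F k) S),
    is_coproduct inj ->
    forall u : mor M (B ⊗ S), finitely_supported (fun k => idm B ⊠ inj k) u.

Lemma relatively_compact_retract M B B' (s : mor B B') (r : mor B' B) :
  r ∘ s = idm B -> relatively_compact M B' -> relatively_compact M B.
Proof.
move=> rs cB' I F S inj injP u.
have -> : u = (r ⊠ idm S) ∘ ((s ⊠ idm S) ∘ u).
  by rewrite composeA -tensm_compl rs tensm1 compose1m.
apply: (finitely_supported_map (p := fun k => r ⊠ idm (F k))
  (inj := fun k => idm B' ⊠ inj k)) (cB' _ _ _ _ injP _).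
by move=> k; rewrite tensm_splitr tensm_splitl.
Qed.

Lemma relatively_compact_iso M B B' :
  iso B B' -> relatively_compact M B -> relatively_compact M B'.
Proof. by move=> e; apply: relatively_compact_retract (ifwdK e). Qed.

Lemma relatively_compact_tens M B T :
  relatively_compact M B -> relatively_compact M (T ⊗ B).
Proof.
move=> cB; apply: (relatively_compact_iso (braid B T)) => I F S inj injP u.
have -> : u = iinv (assoc B T S) ∘ (assoc B T S ∘ u).
  by rewrite composeA iinvK compose1m.
apply: (finitely_supported_map (p := fun k => iinv (assoc B T (F k)))
  (inj := fun k => idm B ⊠ (idm T ⊠ inj k))); last first.
  by apply: cB; apply: tens_coproductr.
move=> k; apply: (iso_mono (e := assoc B T S)); rewrite !composeA ifwdK.
by rewrite compose1m -tensm1 -assoc_nat -composeA ifwdK composem1.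
Qed.

(** For the cone: a map to [Z ⊗ S] becomes finitely supported in [ΣX ⊗ S], so it
    agrees there with its projection to finitely many summands; the difference
    with that projection comes from [Y ⊗ S]. *)
Lemma relatively_compact_thick M : is_thick (relatively_compact M).
Proof.
split; last by move=> X Y s r rs; apply: relatively_compact_retract rs.
apply: tens_triangulated_sub => [X X0|X Y|R X _|X Y Z f g h fgh _ cY csX _].
- move=> I F S inj _ u; exists [::]; rewrite big_nil.
  by apply: mor_to_zero; apply: tens_zerol.
- exact: relatively_compact_iso.
- exact: relatively_compact_tens.
move=> I F S inj injP u.
have [p [pinj pinj0]] := coproduct_proj injP.
have [|j k jk|s _ hu] := finitely_supported_finite
  (inj := fun k => idm (susp X) ⊠ inj k) (p := fun k => idm (susp X) ⊠ p k)
  (u := (h ⊠ idm S) ∘ u) _ _ (csX _ _ _ _ injP _).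
- by move=> k; rewrite -tensm_compr pinj tensm1.
- by rewrite -tensm_compr pinj0 // tensm0r.
(* The part of [u] in the summands from [s]; [h] kills what is left of [u]. *)
pose t := (\sum_(k <- s) (idm Z ⊠ inj k) ∘ (idm Z ⊠ p k)) ∘ u.
have ut0 : (h ⊠ idm S) ∘ (u - t) = 0.
  rewrite compmB /t composeA compm_sum {1}hu composeA comp_summ.
  apply/eqP; rewrite subr_eq0; apply/eqP; congr (_ ∘ _); apply: eq_bigr => k _.
  rewrite -!composeA tensm_splitl composeA.
  by rewrite tensm_splitr -!tensmM compose1m composem1.
have [v vE] := tens_exact (proj1 (dist_rotate _ _ _) fgh) ut0.
have -> : u = t + (g ⊠ idm S) ∘ v by rewrite -vE addrC subrK.
apply: finitely_supportedD.
  rewrite /t comp_summ; apply: finitely_supported_sum => k.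
  by rewrite -composeA; apply: (finitely_supported_inj (fun k => idm Z ⊠ inj k)).
apply: (finitely_supported_map (p := fun k => g ⊠ idm (F k))
  (inj := fun k => idm Y ⊠ inj k)) (cY _ _ _ _ injP _).
by move=> k; rewrite tensm_splitr tensm_splitl.
Qed.

(** The dual of [W] is a retract of [DW ⊗ W ⊗ DW], which lies in every tensor
    ideal containing [W]. *)
Lemma relatively_compact_dual M W :
  rigid W -> relatively_compact M W -> relatively_compact M (tt_dual W).
Proof.
move=> rW cW; have [s [r rs]] := tens_dual_retract rW tunit.
apply: (relatively_compact_iso (lunit _)).
apply: relatively_compact_retract rs _.
apply: (relatively_compact_iso (braid (tt_dual W) (tunit ⊗ tt_dual W ⊗ W))).
by do 2!apply: relatively_compact_tens.
Qed.

(** Maps from [M ⊗ W] to [S] are maps from [M] to [S ⊗ DW]. *)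
Lemma relatively_compact_rigid M W :
  rigid W -> relatively_compact M W -> rigid (W ⊗ M).
Proof.
move=> rW cW; apply: fs_rigid => I F S inj injP u.
pose t := dual_transpose rW (u ∘ braid M W).
have ft : finitely_supported (fun k => inj k ⊠ idm (tt_dual W)) t.
  have -> : t = braid (tt_dual W) S ∘ (braid S (tt_dual W) ∘ t).
    by rewrite composeA braidK compose1m.
  apply: (finitely_supported_map (p := fun k => braid (tt_dual W) (F k))
    (inj := fun k => idm (tt_dual W) ⊠ inj k)); last first.
    exact: (relatively_compact_dual rW cW).
  by move=> k; rewrite braid_nat.
have -> : u = dual_pairing W S ∘ (t ⊠ idm W) ∘ braid W M.
  by rewrite dual_transposeK -composeA braidK composem1.
apply: finitely_supported_comp.
apply: (finitely_supported_map (p := fun k => dual_pairing W (F k))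
  (inj := fun k => (inj k ⊠ idm (tt_dual W)) ⊠ idm W)).
  by move=> k; rewrite dual_pairing_nat.
apply: (finitely_supported_fmap (F := tens_functor W) _ ft).
by move=> A B v w; rewrite /= tensmDl.
Qed.

End TT.

(** * Geometric functors *)

Section Geometric.
Variables (C D : ttCategory).
Hypotheses (hC : rigidly_compactly_generated C)
  (hD : rigidly_compactly_generated D).
Variables (f : geometric_functor C D).
Variables (f_push : functor D C) (adj_push : adjunction f f_push).
Variables (f_shriek : functor C D) (adj_shriek : adjunction f_push f_shriek).

Let sm := geo_monoidal f.

Lemma pullback_additive : additive_functor f.
Proof. exact: exact_additive (geo_exact f). Qed.

Lemma push_additive : additive_functor f_push.
Proof. exact: right_adjoint_additive adj_push pullback_additive. Qed.

Lemma pullback_exact (X Y Z : C) (W T : D) (u : mor X Y) (v : mor Y Z)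
    (w : mor Z (susp X)) (t : mor T (f Y ⊗ W)) :
  dist u v w -> (fmap f v ⊠ idm W) ∘ t = 0 ->
  exists t', t = (fmap f u ⊠ idm W) ∘ t'.
Proof. by move=> uvw; apply: (tens_exact (exact_dist (geo_exact f) uvw)). Qed.

Definition pull_lax : lax_module (self_action C) (pullback_action sm) f :=
  strong_monoidal_lax sm.

Lemma pull_strong N X : is_iso (pull_lax N X).
Proof. exact: iso_is_iso. Qed.

Definition push_lax : lax_module (pullback_action sm) (self_action C) f_push :=
  right_adjoint_lax adj_push pull_strong.

(** Transposition turns maps into [f_push] of the sequence into maps into the
    sequence itself. *)
Lemma push_exact (X Y Z : C) (W : D) (T : C) (u : mor X Y) (v : mor Y Z)
    (w : mor Z (susp X)) (t : mor T (f_push (f Y ⊗ W))) :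
  dist u v w -> fmap f_push (fmap f v ⊠ idm W) ∘ t = 0 ->
  exists t', t = fmap f_push (fmap f u ⊠ idm W) ∘ t'.
Proof.
move=> uvw vt0.
have [|s sE] := pullback_exact (W := W)
    (t := counit_adj adj_push _ ∘ fmap f t) uvw.
  rewrite composeA counit_adj_nat -composeA -fmapM vt0.
  by rewrite additive0 ?compm0 //; apply: pullback_additive.
exists (transpose adj_push s); apply: (transpose_inj (adj := adj_push)).
by rewrite sE fmapM [RHS]composeA -counit_adj_nat -composeA transposeK.
Qed.

(** The objects [N] satisfying the projection formula form a localising
    subcategory: both sides are exact in [N], and they commute with coproducts
    since [f_push] has a right adjoint. It contains the rigid objects, which
    generate. *)
Theorem projection_formula N (Y : D) : is_iso (push_lax N Y).
Proof.
have [[_ [I [G [Gc Ggen]]]] rC] := hC.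
move: N Y.
apply: (Ggen (fun N => forall Y : D, is_iso (push_lax N Y))); last first.
  by move=> k Y; apply: lax_rigid_iso; apply/rC.
split.
  apply: (tens_triangulated_sub hC) => [X X0 Y|X X' e lX Y|R X rR lX Y|].
  - have Z1 : is_zero (self_action C X (f_push Y)) by apply: tens_zerol.
    have Z2 : is_zero (f_push (pullback_action sm X Y)).
      apply: (right_adjoint_zero adj_push); apply: tens_zerol.
      exact: additive_zero pullback_additive _ X0.
    by exists 0; split; rewrite [LHS]mor_to_zero // [RHS]mor_to_zero.
  - have E := lax_nat push_lax e (idm Y); rewrite fmap1 in E.
    apply: (is_iso_compr (f := actm (self_action C) e (idm (f_push Y)))).
      by apply: tensm_is_iso; [apply: iso_is_iso | apply: id_is_iso].
    rewrite -E; apply: is_iso_comp (lX Y); apply: fmap_is_iso.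
    apply: tensm_is_iso (id_is_iso _); apply: fmap_is_iso; exact: iso_is_iso.
  - apply: lax_tens_iso (lX Y); exact: lax_rigid_iso.
  move=> X Y Z u v w uvw lX lY lsX lsY W.
  have vwu := proj1 (dist_rotate _ _ _) uvw.
  have wuv := proj1 (dist_rotate _ _ _) vwu.
  have nat A B (n : mor A B) : push_lax B W ∘ (n ⊠ idm (f_push W))
      = fmap f_push (fmap f n ⊠ idm W) ∘ push_lax A W.
    by have := lax_nat push_lax n (idm W); rewrite fmap1 => ->.
  apply: (five_lemma (nat _ _ u) (nat _ _ v) (nat _ _ w)
           (nat _ _ (- fmap susp u))); last first.
  - exact: lsY.
  - exact: lsX.
  - exact: lY.
  - exact: lX.
  - by move=> T t; apply: push_exact vwu.
  - by move=> T t; apply: push_exact uvw.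
  - by move=> T t; apply: tens_exact wuv.
  - by move=> T t; apply: tens_exact vwu.
  - rewrite -fmapM -tensm_compl -fmapM (dist_comp0 wuv).
    rewrite additive0; last exact: pullback_additive.
    by rewrite tensm0l additive0 //; apply: push_additive.
  - by rewrite -tensm_compl (dist_comp0 uvw) tensm0l.
move=> J F S inj injP lF Y.
apply: (coproduct_iso (p := fun k => push_lax (F k) Y)
  (inj := fun k => inj k ⊠ idm (f_push Y))
  (inj' := fun k => fmap f_push (fmap f (inj k) ⊠ idm Y))) => //.
- exact: tens_coproduct.
- apply: (left_adjoint_coproduct adj_shriek); apply: tens_coproduct.
  exact: geo_coproducts.
- by move=> k; have := lax_nat push_lax (inj k) (idm Y); rewrite fmap1 => ->.
- by move=> k; apply: lF.
Qed.

Definition shriek_lax :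
    lax_module (self_action C) (pullback_action sm) f_shriek :=
  right_adjoint_lax adj_shriek projection_formula.

(** By the projection formula maps from [M] to [f_push 1 ⊗ S] are maps from
    [f M] to [f S]. *)
Lemma push_unit_relatively_compact M :
  rigid (f M) -> relatively_compact M (f_push tunit).
Proof.
move=> rM I F S inj injP u.
pose e X : iso (f_push (f X)) (f_push tunit ⊗ X) :=
  iso_trans (fmap_iso f_push (iso_sym (runit (f X))))
   (iso_trans (iso_sym (iso_of (projection_formula X tunit)))
     (braid X (f_push tunit))).
have e_nat X X' (x : mor X X') :
    (idm (f_push tunit) ⊠ x) ∘ e X = e X' ∘ fmap f_push (fmap f x).
  have lN := lax_nat push_lax x (idm (tunit : D)); rewrite fmap1 in lN.
  pose p Y := iso_of (projection_formula Y tunit).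
  have E1 : iinv (p X') ∘ fmap f_push (fmap f x ⊠ idm tunit)
      = (x ⊠ idm (f_push tunit)) ∘ iinv (p X).
    by apply: iso_inv_nat; rewrite !iso_ofE.
  have E2 : iinv (runit (f X')) ∘ fmap f x
      = (fmap f x ⊠ idm tunit) ∘ iinv (runit (f X)).
    by apply: iso_inv_nat; rewrite runit_nat.
  rewrite /= !composeA braid_nat -!composeA; congr (_ ∘ _).
  by rewrite composeA -E1 -composeA -!fmapM E2 fmapM.
have -> : u = e S ∘ (iinv (e S) ∘ u) by rewrite composeA ifwdK compose1m.
apply: (finitely_supported_map (p := fun k => e (F k))
  (inj := fun k => fmap f_push (fmap f (inj k)))) => //.
set v := iinv (e S) ∘ u.
have -> : v = transpose adj_push (counit_adj adj_push (f S) ∘ fmap f v).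
  by apply: (transpose_inj (adj := adj_push)); rewrite transposeK.
apply: finitely_supported_comp.
apply: (finitely_supported_fmap (inj := fun k => fmap f (inj k)) push_additive).
by apply: (rigid_fs hD rM); apply: geo_coproducts.
Qed.

Hypothesis push_small : proxy_small adj_push.

(** [f_push (Z ⊗ Y)] is a retract of [f_push 1 ⊗ f_push (Z ⊗ Y)], as for any
    module over the ring [f_push 1]; the latter is [f_push] of
    [f (f_push 1) ⊗ (Z ⊗ Y)]. *)
Lemma push_unit_tens_zero (Z : D) :
  is_zero (f (f_push tunit) ⊗ Z) -> forall Y : D, is_zero (f_push (Z ⊗ Y)).
Proof.
move=> AZ0 Y; set Q := f_push (Z ⊗ Y).
apply: (retract_zero (triangle_r adj_push (Z ⊗ Y))); rewrite -/Q.
have QA0 : is_zero (Q ⊗ f_push tunit).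
  apply: (iso_zero (braid (f_push tunit) Q)).
  pose p := iso_of (projection_formula (f_push tunit) (Z ⊗ Y)).
  apply: (iso_zero (iso_sym p)).
  apply: (right_adjoint_zero adj_push).
  apply: (iso_zero (assoc (f (f_push tunit)) Z Y)); exact: tens_zerol.
apply: (iso_zero (fmap_iso f_push (runit (f Q)))).
exact: (iso_zero (iso_of (projection_formula Q tunit))).
Qed.

(** Since [f] of the unit is the unit, [f_push (Z ⊗ DG) = 0] implies that
    no nonzero map from a rigid [G] reaches [Z]. *)
Lemma push_tens_zero (Z : D) :
  (forall Y, is_zero (f_push (Z ⊗ Y))) -> is_zero Z.
Proof.
have [[_ [I [G [Gc Ggen]]]] rD] := hD.
pose H (Z : D) := forall Y, is_zero (f_push (Z ⊗ Y)).
have H_tens W Y : H W -> H (W ⊗ Y).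
  move=> HW Y'; apply: (iso_zero (fmap_iso f_push (iso_sym (assoc W Y Y')))).
  exact: HW.
have H_unit W (u : mor tunit W) : H W -> u = 0.
  move=> HW; have W0 : is_zero (f_push W).
    exact: (iso_zero (fmap_iso f_push (runit W)) (HW tunit)).
  apply: (iso_epi (e := iso_sym (sm_unit sm))).
  rewrite /= comp0m -[LHS](transposeK adj_push) (mor_to_zero (transpose _ _) W0).
  by rewrite additive0 ?compm0 //; apply: pullback_additive.
have H_rigid R W (u : mor R W) : rigid R -> H W -> u = 0.
  move=> rR HW; apply: (iso_epi (e := lunit R)).
  rewrite comp0m -[LHS](dual_transposeK rR).
  by rewrite (H_unit _ (dual_transpose _ _) (H_tens _ _ HW)) tensm0l compm0.
suff H_all X W (u : mor X W) : H W -> u = 0 by move=> HZ; apply: H_all HZ.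
move: X W u; apply: (Ggen (fun X => forall W (u : mor X W), H W -> u = 0));
  last first.
  by move=> k W u; apply: H_rigid; apply/rD.
split.
  apply: (tens_triangulated_sub hD)
    => [X X0 W u _|X X' e HX W u HW|R X rR HX W u HW|].
  - exact: mor_from_zero.
  - by apply: (iso_epi (e := e)); rewrite comp0m; apply: HX HW.
  - apply: (iso_epi (e := braid X R)); rewrite comp0m -[LHS](dual_transposeK rR).
    by rewrite (HX _ (dual_transpose _ _) (H_tens _ _ HW)) tensm0l compm0.
  move=> X Y Z' u v w uvw HX HY HsX HsY W t HW.
  have vwu := proj1 (dist_rotate _ _ _) uvw.
  have [|t' ->] := dist_extend vwu (u := t); first exact: HY.
  by rewrite (HsX _ t' HW) comp0m.
move=> J F S inj injP HF W u HW; apply: (coproduct_ext injP) => k.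
by rewrite comp0m; apply: HF HW.
Qed.

(** The comparison map becomes invertible after tensoring with each [f (W k)],
    because [W k] and [W k ⊗ M] are rigid; the cone argument removes the factor
    [f (W k)] by passing to the localising tensor ideal generated by the
    [W k], which contains [f_push 1]. *)
Lemma shriek_iso M X : rigid (f M) -> is_iso (shriek_lax M X).
Proof.
move=> rM; have [I [W [Wc Wthick Wloc]]] := push_small.
have rW k : rigid (W k) by apply/(proj2 hC).
have cW k : relatively_compact M (W k).
  apply: (Wthick k); first exact: relatively_compact_thick.
    by move=> R B _; apply: relatively_compact_tens.
  by move=> B ->; apply: push_unit_relatively_compact.
have WI k : is_iso (idm (f (W k)) ⊠ shriek_lax M X).
  have lI : is_iso (shriek_lax (W k ⊗ M) X).
    by apply: lax_rigid_iso; apply: relatively_compact_rigid.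
  have := lax_isor lI (lax_rigid_iso _ (rW k) _).
  by rewrite /= fmap1.
have [Z [g [h sgh]]] := dist_complete (shriek_lax M X).
apply: (cone_zero_iso sgh); apply: push_tens_zero; apply: push_unit_tens_zero.
apply: (Wloc (fun T => is_zero (f T ⊗ Z))).
- split.
    apply: (tens_triangulated_sub hC) => [T T0|T T' e T0|R T _ T0|].
    + by apply: tens_zerol; apply: additive_zero pullback_additive _ T0.
    + exact: (iso_zero (tens_iso (fmap_iso f e) (id_iso Z)) T0).
    + apply: (iso_zero (iso_sym (act_assoc (pullback_action sm) R T Z))).
      exact: tens_zeror.
    move=> X1 X2 X3 u v w uvw X10 X20 sX10 _.
    have vwu := proj1 (dist_rotate _ _ _) uvw.
    have [|t tE] := pullback_exact (W := Z) (t := idm (f X3 ⊗ Z)) vwu.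
      exact: mor_to_zero.
    by rewrite /is_zero tE (mor_to_zero t X20) compm0.
  move=> J F S inj injP F0.
  by apply: (coproduct_zero (tens_coproduct (geo_coproducts injP))).
- move=> T B B0.
  apply: (iso_zero (iso_sym (act_assoc (pullback_action sm) T B Z))).
  exact: tens_zeror.
- move=> B [k ->]; apply: (iso_zero (braid Z (f (W k)))).
  apply: (cone_iso_zero (tt_tens_dist (f (W k)) sgh)).
  have -> : shriek_lax M X ⊠ idm (f (W k)) = braid (f (W k)) _
      ∘ (idm (f (W k)) ⊠ shriek_lax M X) ∘ braid _ (f (W k)).
    by rewrite -composeA braid_nat composeA braidK compose1m.
  apply: is_iso_comp (iso_is_iso _); apply: is_iso_comp (WI k).
  exact: iso_is_iso.
Qed.

End Geometric.

Theorem theorem2 (C D : ttCategory)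
    (hC : rigidly_compactly_generated C) (hD : rigidly_compactly_generated D)
    (f : geometric_functor C D)
    (f_push : functor D C) (adj_push : adjunction f f_push)
    (f_shriek : functor C D) (adj_shriek : adjunction f_push f_shriek)
    (hf : proxy_small adj_push)
    (M : C) (hM : rigid (f M)) :
  (exists eta : forall X : C, iso (f_shriek X ⊗ f M) (f_shriek (X ⊗ M)),
     forall (X Y : C) (u : mor X Y),
       fmap f_shriek (u ⊠ idm M) ∘ eta X
       = eta Y ∘ (fmap f_shriek u ⊠ idm (f M)))
  /\ isomorphic (f_shriek tunit ⊗ f M) (f_shriek M).
Proof.
pose l := shriek_lax hC adj_push adj_shriek.
have lI X : is_iso (l M X) by apply: shriek_iso.
pose eta X : iso (f_shriek X ⊗ f M) (f_shriek (X ⊗ M)) :=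
  iso_trans (braid (f_shriek X) (f M))
    (iso_trans (iso_of (lI X)) (fmap_iso f_shriek (braid M X))).
split; last first.
  by split; apply: (iso_trans (eta tunit)); apply: (fmap_iso f_shriek (lunit M)).
exists eta => X Y u; have lN := lax_nat l (idm M) u.
rewrite /= fmap1 !iso_ofE in lN *.
rewrite !composeA -fmapM braid_nat fmapM -(composeA _ _ (l M X)) lN.
by rewrite -!composeA braid_nat.
Qed.
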